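(* Assume that the reduced chain $Y$ is irreducible. Let $\pi=(\pi_A,\pi_B)$ be a probability distribution on the state space $S$ and let $\gamma(\pi)=\pi_B+\pi_A(I-\Omega_{AA})^{-1}\Omega_{AB}$, which is a probability distribution on $B$. Then for any $h>0$, $$\lim_{\lambda\to\infty}\ \sup_{t\ge h} d_{TV}\bigl(P^\lambda_\pi(X_t\in\cdot),\,P_{\gamma(\pi)}(Y_t\in\cdot)\bigr)=0 .$$
   Context: Setting. $S=\{1,\dots,|S|\}$ is a finite set. For each $\lambda>0$, $Q(\lambda)=(q_{ij}(\lambda))$ is an irreducible transition rate matrix on $S$ (nonnegative off-diagonal entries, rows summing to $0$), and $X=\{X_t:t\ge0\}$ is the continuous-time Markov chain on $S$ with transition rate matrix $Q(\lambda)$; $P^\lambda_\pi$ denotes its law with initial distribution $\pi$, and $P^\lambda_i$ its law started from state $i$. For all $i\ne j$, $\lim_{\lambda\to\infty}q_{ij}(\lambda)$ exists in $[0,\infty]$. Put $q_i(\lambda)=-q_{ii}(\lambda)=\sum_{j\ne i}q_{ij}(\lambda)$ and $q_i=\lim_{\lambda\to\infty}q_i(\lambda)\in[0,\infty]$. The fast state space is $A=\{i:q_i=\infty\}$ and the slow state space is $B=\{i:q_i<\infty\}$; it is assumed that $B\neq\emptyset$ and $q_i>0$ for all $i\in B$. States are labelled so that those of $A$ come first, and matrices on $S$ are written in blocks with indices $A,B$ (row vectors likewise, so $\pi=(\pi_A,\pi_B)$ is a row vector). $Q=\lim_{\lambda\to\infty}Q(\lambda)$ entrywise; the blocks $Q_{BA},Q_{BB}$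 have finite entries. Jump chain. $\Omega(\lambda)=(\omega_{ij}(\lambda))$ with $\omega_{ij}(\lambda)=q_{ij}(\lambda)/q_i(\lambda)$ for $i\neq j$ and $\omega_{ii}(\lambda)=0$. It is assumed that $\lim_{\lambda\to\infty}\omega_{ij}(\lambda)$ exists for all $i\ne j$; $\Omega=\lim_{\lambda\to\infty}\Omega(\lambda)$ is a stochastic matrix. Let $\eta=\{\eta_n\}_{n\ge0}$ be the discrete-time Markov chain with transition matrix $\Omega$ and $T_B=\inf\{n\ge0:\eta_n\in B\}$; it is assumed that $P_i(T_B<\infty)=1$ for all $i\in A$. Then $I-\Omega_{AA}$ is invertible. Reduced chain. $Y=\{Y_t:t\ge0\}$ is the continuous-time Markov chain on $B$ with transition rate matrix $\Gamma=Q_{BB}+Q_{BA}(I-\Omega_{AA})^{-1}\Omega_{AB}$; $P_\nu$ denotes its law with initial distribution $\nu$ on $B$. Distributions on $B$ are regarded as distributions on $S$ giving mass $0$ to $A$. Total variation distance: $d_{TV}(\mu,\nu)=\frac12\sum_{i\in S}|\mu_i-\nu_i|$ for probability measures $\mu,\nu$ on $S$. *)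

(* Defs.v *)
From HB Require Import structures.
From mathcomp Require Export all_boot all_order all_algebra.
From mathcomp Require Export all_classical all_reals all_analysis.
Export Order.TTheory GRing.Theory Num.Theory.
Export numFieldNormedType.Exports.

Set Implicit Arguments.
Unset Strict Implicit.
Unset Printing Implicit Defensive.

#[global] Open Scope classical_set_scope.
#[global] Open Scope ring_scope.

(* Distributions on 'I_n are row vectors, so that the law at time t of a chain
   started from mu is mu *m P_t. *)
Definition is_distribution (R : realType) n (mu : 'rV[R]_n) : Prop :=
  (forall i, 0 <= mu 0 i) /\ \sum_i mu 0 i = 1.

Definition dTV (R : realType) n (mu nu : 'rV[R]_n) : R :=
  2^-1 * \sum_(i < n) `|mu 0 i - nu 0 i|.

Definition law d (T : measurableType d) (R : realType) n
    (P : probability T R) (X : T -> 'I_n) : 'rV[R]_n :=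
  \row_i fine (P (X @^-1` [set i])).

Definition is_rate_matrix (R : realType) n (Q : 'M[R]_n) : Prop :=
  (forall i j, i != j -> 0 <= Q i j) /\ (forall i, \sum_j Q i j = 0).

(* The diagonal of a rate matrix is nonpositive, so only genuine jumps are
   edges; [connect] is reflexive, so a one-state chain is irreducible. *)
Definition irreducible_rates (R : realType) n (Q : 'M[R]_n) : Prop :=
  forall i j, connect [rel x y | 0 < Q x y] i j.

(* Entrywise limit of the partial sums of \sum_k A^k / k!. *)
Definition expmx (R : realType) n (A : 'M[R]_n) : 'M[R]_n :=
  \matrix_(i, j) limn (series (fun k : nat => k`!%:R^-1 * (A ^+ k) i j)).

(* X is indexed by all of R; only its values at times t >= 0 are constrained.
   The chain is specified by its finite-dimensional distributions at times
   0 = t 0 <= t 1 <= ... <= t k, with transition function t |-> exp (t Q). *)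
Definition is_ctmc d (T : measurableType d) (R : realType) n
    (P : probability T R) (X : R -> T -> 'I_n)
    (Q : 'M[R]_n) (mu : 'rV[R]_n) : Prop :=
  (forall t i, 0 <= t -> measurable (X t @^-1` [set i])) /\
  (forall (k : nat) (t : nat -> R) (s : nat -> 'I_n),
    t 0%N = 0 -> (forall m, (m < k)%N -> t m <= t m.+1) ->
    P [set w | forall m, (m <= k)%N -> X (t m) w = s m] =
    (mu 0 (s 0%N) *
      \prod_(0 <= m < k) expmx ((t m.+1 - t m) *: Q) (s m) (s m.+1))%:E).

Definition is_dtmc d (T : measurableType d) (R : realType) n
    (P : probability T R) (eta : nat -> T -> 'I_n)
    (W : 'M[R]_n) (mu : 'rV[R]_n) : Prop :=
  (forall m i, measurable (eta m @^-1` [set i])) /\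
  (forall (k : nat) (s : nat -> 'I_n),
    P [set w | forall m, (m <= k)%N -> eta m w = s m] =
    (mu 0 (s 0%N) * \prod_(0 <= m < k) W (s m) (s m.+1))%:E).

(* inf {m | eta_m(w) in B}, which is +oo when B is never visited. *)
Definition hitting_time (T : Type) (R : realType) (S : Type)
    (eta : nat -> T -> S) (B : pred S) (w : T) : \bar R :=
  ereal_inf [set (m%:R)%:E | m in [set m : nat | B (eta m w)]].

Definition exit_rate (R : realType) n (Q : R -> 'M[R]_n) (l : R) (i : 'I_n) : R :=
  - Q l i i.

Definition exit_rate_lim (R : realType) n (Q : R -> 'M[R]_n) (i : 'I_n) : \bar R :=
  lim ((exit_rate Q l i)%:E @[l --> +oo]).

Definition fast (R : realType) n (Q : R -> 'M[R]_n) : pred 'I_n :=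
  fun i => exit_rate_lim Q i == +oo%E.

Definition slow (R : realType) n (Q : R -> 'M[R]_n) : pred 'I_n :=
  fun i => (exit_rate_lim Q i < +oo)%E.

Definition rate_lim (R : realType) n (Q : R -> 'M[R]_n) : 'M[\bar R]_n :=
  \matrix_(i, j) lim ((Q l i j)%:E @[l --> +oo]).

Definition jump_matrix (R : realType) n (Q : R -> 'M[R]_n) (l : R) : 'M[R]_n :=
  \matrix_(i, j) if i == j then 0 else Q l i j / exit_rate Q l i.

Definition jump_lim (R : realType) n (Q : R -> 'M[R]_n) : 'M[R]_n :=
  \matrix_(i, j) lim (jump_matrix Q l i j @[l --> +oo]).

(* In what follows the state space is 'I_(a + b), whose first a elements are
   meant to be the fast states and the last b the slow ones. *)

(* (I - Omega_AA)^-1 Omega_AB *)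
Definition absorption_matrix (R : realType) a b
    (Q : R -> 'M[R]_(a + b)) : 'M[R]_(a, b) :=
  invmx (1%:M - ulsubmx (jump_lim Q)) *m ursubmx (jump_lim Q).

(* [fine] is harmless: the slow rows of the limiting rate matrix are finite. *)
Definition reduced_rates (R : realType) a b
    (Q : R -> 'M[R]_(a + b)) : 'M[R]_b :=
  map_mx fine (drsubmx (rate_lim Q)) +
  map_mx fine (dlsubmx (rate_lim Q)) *m absorption_matrix Q.

Definition reduced_distribution (R : realType) a b
    (Q : R -> 'M[R]_(a + b)) (mu : 'rV[R]_(a + b)) : 'rV[R]_b :=
  rsubmx mu + lsubmx mu *m absorption_matrix Q.

(* A distribution on the slow states, seen on the whole state space. *)
Definition extend_by_zero (R : realType) a b (nu : 'rV[R]_b) : 'rV[R]_(a + b) :=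
  row_mx 0 nu.
Arguments extend_by_zero {R} a {b} nu.

(* Main.v *)
Require Import Defs.
From mathcomp Require Import ring lra.

(* For a fixed rate matrix Q = Q(l), write J = (K ; I) with K = (I - U)^-1 V and
   U, V the blocks Omega_AA, Omega_AB.  Since s |-> exp((t-s)Q) F(s) is monotone
   whenever F is a supersolution of F' = QF, explicit supersolutions built from
   z = 2 (I - U)^-1 1 give two bounds: exp(tQ) J is close to J exp(tG) as soon
   as QJ - JG is small relative to the exit rates, and the mass exp(tQ) 1_A of
   the fast states is small for t >= delta as soon as the fast exit rates are
   large.  Hence exp(tQ) is close to the kernel S_t = (0, J exp(tG)), uniformly
   for t in [h, 2h].  Both families are semigroups, and irreducibility of G makes
   S_h a strict contraction of row vectors of total mass 0, so closeness on
   [h, 2h] propagates to all t >= h. *)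

Set Implicit Arguments.
Unset Strict Implicit.
Unset Printing Implicit Defensive.

(** * The matrix exponential *)

(** Fast states may have rates diverging at different speeds, so on a fast row [Q J - J G] need not
    tend to 0. Only its ratio to the exit rate does, because the limiting jump matrix fixes [J] on
    fast rows. Errors are therefore measured by a weight [d], later the exit rate on fast rows and 1
    on slow rows. The point is that [d] accumulates boundedly along the chain: [d <= C - Q z], with
    [z] independent of the parameter, makes [z + C t] dominate the expected integral of [d] up to
    time [t], however large the rates. The constant [C] pays for the slow rows, where [Q z] is
    merely bounded. This bound grows linearly in [t], hence the separate contraction argument for
    large times; and a chain started in a fast state still has mass there at time 0, hence times
    bounded away from 0. *)

Lemma expr_mx_bound (R : realType) n (A : 'M[R]_n) k i j :
  `|(A ^+ k) i j| <= (\sum_i \sum_j `|A i j|) ^+ k.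
Proof.
set c := \sum_i _.
have c_ge0 : 0 <= c by apply: sumr_ge0 => ? _; apply: sumr_ge0.
elim: k i j => [|k IHk] i j.
  by rewrite !expr0 mxE; case: eqP; rewrite ?normr1 ?normr0 ?ler01.
rewrite exprS -mulmxE mxE (le_trans (ler_norm_sum _ _ _))//.
apply: (@le_trans _ _ (\sum_l `|A i l| * c ^+ k)).
  by apply: ler_sum => l _; rewrite normrM ler_wpM2l.
rewrite -mulr_suml exprS ler_wpM2r ?exprn_ge0//.
rewrite /c [leRHS](bigD1 i)//= lerDl.
by apply: sumr_ge0 => ? _; apply: sumr_ge0.
Qed.

Lemma expr_mxZ (R : realType) n (A : 'M[R]_n) t k :
  (t *: A) ^+ k = t ^+ k *: A ^+ k.
Proof.
elim: k => [|k IHk]; first by rewrite !expr0 scale1r.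
by rewrite !exprS IHk -!mulmxE -scalemxAl -scalemxAr scalerA.
Qed.

(** Fixing an entry turns the exponential into a scalar power series in [t], to which termwise
    differentiation applies. *)
Definition expmx_coef (R : realType) n (A : 'M[R]_n) i j (k : nat) : R :=
  k`!%:R^-1 * (A ^+ k) i j.

Lemma expmx_pseries (R : realType) n (A : 'M[R]_n) i j :
  (fun t => expmx (t *: A) i j) = (fun t => limn (pseries (expmx_coef A i j) t)).
Proof.
apply/funext => t; rewrite mxE /pseries /expmx_coef.
congr (limn (series _)); apply/funext => k.
by rewrite expr_mxZ mxE mulrCA mulrC.
Qed.

Lemma is_cvg_expmx_pseries (R : realType) n (A : 'M[R]_n) i j t :
  cvgn (pseries (expmx_coef A i j) t).
Proof.
apply: normed_cvg; pose c := \sum_i \sum_j `|A i j|.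
have c_ge0 : 0 <= c by apply: sumr_ge0 => ? _; apply: sumr_ge0.
apply: (@series_le_cvg _ _ (fun k => exp_coeff (c * `|t|) k)).
- by move=> k; rewrite /= normr_ge0.
- by move=> k; apply: exp_coeff_ge0; rewrite mulr_ge0.
- move=> k; rewrite /exp_coeff /expmx_coef /= !normrM normrX exprMn.
  rewrite ger0_norm ?invr_ge0// -mulrA mulrC ler_wpM2r ?invr_ge0//.
  by rewrite ler_wpM2r ?exprn_ge0 ?expr_mx_bound.
- exact: is_cvg_series_exp_coeff.
Qed.

Lemma pseries_diffs_expmx (R : realType) n (A : 'M[R]_n) i j :
  pseries_diffs (expmx_coef A i j) =
  (fun k => \sum_l A i l * expmx_coef A l j k).
Proof.
apply/funext => k; rewrite /pseries_diffs /expmx_coef exprS -mulmxE mxE.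
rewrite factS natrM invfM mulrA mulrA divff ?pnatr_eq0// mul1r mulr_sumr.
by apply: eq_bigr => l _; ring.
Qed.

Lemma pseries_diffs_expmxr (R : realType) n (A : 'M[R]_n) i j :
  pseries_diffs (expmx_coef A i j) =
  (fun k => \sum_l expmx_coef A i l k * A l j).
Proof.
apply/funext => k; rewrite /pseries_diffs /expmx_coef exprSr -mulmxE mxE.
rewrite factS natrM invfM mulrA mulrA divff ?pnatr_eq0// mul1r mulr_sumr.
by apply: eq_bigr => l _; ring.
Qed.

Lemma cvg_pseries_sum (R : realType) (I : Type) (r : seq I) (c : I -> R)
    (u : I -> R^nat) (t : R) :
  (forall l, cvgn (pseries (u l) t)) ->
  pseries (fun k => \sum_(l <- r) c l * u l k) t @ \oo -->
    \sum_(l <- r) c l * limn (pseries (u l) t).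
Proof.
move=> u_cvg.
rewrite (_ : pseries _ t = fun m => \sum_(l <- r) c l * pseries (u l) t m); last first.
  apply/funext => m; rewrite /pseries /series /=.
  under eq_bigr do rewrite mulr_suml; rewrite exchange_big /=.
  apply: eq_bigr => l _; rewrite mulr_sumr.
  by apply: eq_bigr => k _; rewrite mulrA.
elim: r => [|l r IHr].
  by rewrite big_nil; under eq_fun do rewrite big_nil; exact: cvg_cst.
rewrite big_cons; under eq_fun do rewrite big_cons.
by apply: cvgD => //; apply: cvgMr; exact: u_cvg.
Qed.

Lemma limn_pseries_diffs_expmx (R : realType) n (A : 'M[R]_n) i j t :
  pseries (pseries_diffs (expmx_coef A i j)) t @ \oo -->
    (A *m expmx (t *: A)) i j.
Proof.
rewrite pseries_diffs_expmx mxE.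
under eq_bigr do rewrite (congr1 (@^~ t) (expmx_pseries _ _ _)).
by apply: cvg_pseries_sum => l; exact: is_cvg_expmx_pseries.
Qed.

(** Both sides sum the same differentiated series, with [A ^+ k.+1] split as [A * A ^+ k] or as
    [A ^+ k * A]. *)
Lemma expmx_comm (R : realType) n (A : 'M[R]_n) t :
  expmx (t *: A) *m A = A *m expmx (t *: A).
Proof.
apply/matrixP => i j.
have /cvg_lim <- // := @limn_pseries_diffs_expmx R n A i j t.
apply/esym/cvg_lim => //.
rewrite pseries_diffs_expmxr mxE.
under eq_bigr do rewrite mulrC (congr1 (@^~ t) (expmx_pseries _ _ _)).
rewrite (_ : (fun k => _) = fun k => \sum_l A l j * expmx_coef A i l k); last first.
  by apply/funext => k; apply: eq_bigr => l _; rewrite mulrC.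
by apply: cvg_pseries_sum => l; exact: is_cvg_expmx_pseries.
Qed.

Lemma is_cvg_pseries_diffs2_expmx (R : realType) n (A : 'M[R]_n) i j t :
  cvgn (pseries (pseries_diffs (pseries_diffs (expmx_coef A i j))) t).
Proof.
have -> : pseries_diffs (pseries_diffs (expmx_coef A i j)) =
    (fun k => \sum_l A i l * pseries_diffs (expmx_coef A l j) k).
  rewrite (pseries_diffs_expmx A i j) /pseries_diffs.
  apply/funext => k; rewrite mulr_sumr; apply: eq_bigr => l _.
  by rewrite mulrCA.
apply/cvgP; apply: cvg_pseries_sum => l.
by apply/cvgP; exact: limn_pseries_diffs_expmx.
Qed.

Definition mx_derive (R : realType) m n (F : R -> 'M[R]_(m, n)) (t : R)
    (dF : 'M[R]_(m, n)) :=
  forall i j, is_derive t (1 : R) (fun s => F s i j : R) (dF i j).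

Lemma mx_derive_expmx (R : realType) n (A : 'M[R]_n) t :
  mx_derive (fun s => expmx (s *: A)) t (A *m expmx (t *: A)).
Proof.
move=> i j; rewrite expmx_pseries.
have /cvg_lim <- // := @limn_pseries_diffs_expmx R n A i j t.
(* The series and its first two formal derivatives must converge at a point of modulus larger than
   that of [t]; [|t| + 1] is one. *)
apply: (@pseries_snd_diffs _ _ (`|t| + 1)).
- exact: is_cvg_expmx_pseries.
- by apply/cvgP; exact: limn_pseries_diffs_expmx.
- exact: is_cvg_pseries_diffs2_expmx.
- by rewrite [ltRHS]ger0_norm ?addr_ge0// ltrDl.
Qed.

Lemma expmx0 (R : realType) n : expmx (0 : 'M[R]_n) = 1%:M.
Proof.
apply/matrixP => i j; rewrite mxE; apply/cvg_lim => //.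
(* Every partial sum with at least one term already equals the limit. *)
rewrite -(cvg_shiftn 1) /=.
rewrite (_ : (fun _ => _) = fun=> (1%:M : 'M[R]_n) i j); first exact: cvg_cst.
apply/funext => k; rewrite /series /= addn1 big_nat_recl//.
rewrite big1 ?addr0 ?expr0 ?fact0 ?invr1 ?mul1r// => l _.
by rewrite expr0n/= mxE mulr0.
Qed.

Lemma mx_derive_mul (R : realType) m n p (F : R -> 'M[R]_(m, n))
    (G : R -> 'M[R]_(n, p)) t dF dG :
  mx_derive F t dF -> mx_derive G t dG ->
  mx_derive (fun s => F s *m G s) t (dF *m G t + F t *m dG).
Proof.
move=> dFt dGt i j.
rewrite (_ : (fun s => _) = \sum_l ((fun s => F s i l) * (fun s => G s l j))); last first.
  by apply/funext => s; rewrite fct_sumE mxE.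
apply: is_derive_eq.
  by apply: is_derive_sum => l; apply: is_deriveM; [exact: dFt|exact: dGt].
rewrite !mxE -big_split /=; apply: eq_bigr => l _.
by rewrite addrC /GRing.scale /= (mulrC (G t l j)).
Qed.

Lemma mx_derive_cst (R : realType) m n (M : 'M[R]_(m, n)) t :
  mx_derive (fun=> M) t 0.
Proof. by move=> i j; rewrite mxE; exact: is_derive_cst. Qed.

Lemma mx_derive_add (R : realType) m n (F G : R -> 'M[R]_(m, n)) t dF dG :
  mx_derive F t dF -> mx_derive G t dG ->
  mx_derive (fun s => F s + G s) t (dF + dG).
Proof.
move=> dFt dGt i j; rewrite (_ : (fun s => _) = (fun s => F s i j) + (fun s => G s i j)).
  by rewrite mxE; apply: is_deriveD.
by apply/funext => s; rewrite mxE.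
Qed.

Lemma mx_derive_scale (R : realType) m n (f : R -> R) (M : 'M[R]_(m, n)) (t df : R) :
  is_derive t 1 f df -> mx_derive (fun s => f s *: M) t (df *: M).
Proof.
move=> dft i j; rewrite (_ : (fun s => _) = M i j \*: f).
  by apply: is_derive_eq; rewrite mxE mulrC.
by apply/funext => s; rewrite mxE mulrC.
Qed.

Lemma mx_derive_rev (R : realType) m n (F : R -> 'M[R]_(m, n)) (c t : R) dF :
  mx_derive F (c - t) dF -> mx_derive (fun s => F (c - s)) t (- dF).
Proof.
move=> dFt i j; rewrite mxE -mulrN1.
apply: (@is_derive1_comp _ (fun s => F s i j) (fun s => c - s)) => //.
by have := is_deriveB (is_derive_cst c t (1 : R)) (is_derive_id t (1 : R)); rewrite sub0r.
Qed.

(** Duhamel's formula in differential form: a zero defect [dF - A F] gives uniqueness, a nonnegative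
    one gives comparison. *)
Lemma mx_derive_expmx_rev (R : realType) m n (A : 'M[R]_n) (c t : R)
    (F : R -> 'M[R]_(n, m)) dF :
  mx_derive F t dF ->
  mx_derive (fun s => expmx ((c - s) *: A) *m F s) t
    (expmx ((c - t) *: A) *m (dF - A *m F t)).
Proof.
move=> dFt.
have := mx_derive_mul (mx_derive_rev (@mx_derive_expmx _ _ A (c - t))) dFt.
by rewrite mulNmx -expmx_comm -mulmxA addrC -mulmxBr.
Qed.

(** The Duhamel product is constant in [s], and its values at [s = t] and [s = 0] are the two sides.
    The semigroup law, the scalar shift and the unit row sums all follow from this uniqueness. *)
Lemma expmx_unique (R : realType) m n (A : 'M[R]_n) (F : R -> 'M[R]_(n, m)) t :
  (forall s, mx_derive F s (A *m F s)) -> F t = expmx (t *: A) *m F 0.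
Proof.
move=> dF.
pose H s := expmx ((t - s) *: A) *m F s.
have H' s : mx_derive H s 0.
  by have := mx_derive_expmx_rev A t (dF s); rewrite subrr mulmx0.
have -> : F t = H t by rewrite /H subrr scale0r expmx0 mul1mx.
have -> : expmx (t *: A) *m F 0 = H 0 by rewrite /H subr0.
apply/matrixP => i j.
apply: (@is_derive_0_is_cst _ (fun s => H s i j)) => s.
by have := H' s i j; rewrite mxE.
Qed.

Lemma expmxD (R : realType) n (A : 'M[R]_n) s t :
  expmx ((s + t) *: A) = expmx (s *: A) *m expmx (t *: A).
Proof.
have := @expmx_unique R n n A (fun r => expmx ((r + t) *: A)) s.
rewrite add0r; apply=> r i j.
rewrite -[X in is_derive _ _ _ X]mulr1.
apply: (@is_derive1_comp _ (fun s => expmx (s *: A) i j) (fun s => s + t)).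
  exact: mx_derive_expmx.
by have := is_deriveD (is_derive_id r (1 : R)) (is_derive_cst t r (1 : R)); rewrite addr0.
Qed.

(** All terms are nonnegative, so each bounds the sum from below: the term [k = 0] will give
    nonnegativity, the term of a path's length positivity. *)
Lemma expmx_term_le (R : realType) n (N : 'M[R]_n) t k i j :
  (forall i j, 0 <= N i j) -> 0 <= t ->
  k`!%:R^-1 * (t ^+ k * (N ^+ k) i j) <= expmx (t *: N) i j.
Proof.
move=> N0 t0.
have Nk0 l x y : 0 <= (N ^+ l) x y.
  elim: l x y => [|l IHl] x y; first by rewrite expr0 mxE; case: eqP.
  by rewrite exprS -mulmxE mxE sumr_ge0// => z _; rewrite mulr_ge0.
rewrite (congr1 (@^~ t) (expmx_pseries N i j)).
have c0 l : 0 <= expmx_coef N i j l * t ^+ l.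
  by rewrite /expmx_coef !mulr_ge0 ?exprn_ge0.
apply: (@le_trans _ _ (pseries (expmx_coef N i j) t k.+1)).
  rewrite /pseries /series /= big_nat_recr//= /expmx_coef -mulrA.
  by rewrite [t ^+ k * _]mulrC lerDr sumr_ge0// => l _; exact: c0.
apply: (nondecreasing_cvgn_le _ (@is_cvg_expmx_pseries _ _ _ _ _ _)).
by apply/nondecreasing_seqP => l; rewrite /pseries /series /= big_nat_recr//= lerDl.
Qed.

Lemma expmx_shift (R : realType) n (N : 'M[R]_n) (c t : R) :
  expmx (t *: (N - c%:M)) = expR (- c * t) *: expmx (t *: N).
Proof.
have := @expmx_unique R n n (N - c%:M)
  (fun s => expR (- c * s) *: expmx (s *: N)) t.
rewrite mulr0 scale0r expmx0 expR0 scale1r mulmx1 => <- // s i j.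
have dE : is_derive s (1 : R) (fun r => expR (- c * r)) (expR (- c * s) * - c).
  apply: (@is_derive1_comp _ (@expR R) (fun r => - c * r)).
  have := @is_deriveZ _ _ _ (fun r : R => r) (- c) s (1 : R) _ (is_derive_id s (1 : R)).
  by rewrite /GRing.scale /= mulr1.
rewrite (_ : (fun _ => _) =
    (fun s => expR (- c * s)) * (fun s => expmx (s *: N) i j)); last first.
  by apply/funext => r; rewrite mxE.
apply: is_derive_eq; first exact: (is_deriveM dE (mx_derive_expmx N s i j)).
rewrite -scalemxAr mulmxBl mul_scalar_mx !mxE /GRing.scale /=; ring.
Qed.

(** * Transition functions of rate matrices *)

(** Uniformization: [c] dominates every exit rate, so exp(tQ) is a positive scalar times the
    exponential of a nonnegative matrix. The bound [Q i j <= N i j] carries the edges of [Q] over to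
    [N]. *)
Lemma rate_matrix_uniformize (R : realType) n (Q : 'M[R]_n) :
  is_rate_matrix Q ->
  exists c, exists2 N : 'M[R]_n, Q = N - c%:M &
    forall i j, 0 <= N i j /\ Q i j <= N i j.
Proof.
case=> Q0 Q1; pose c := \sum_i `|Q i i|.
exists c; exists (Q + c%:M); first by rewrite addrK.
have c0 : 0 <= c by apply: sumr_ge0.
move=> i j; rewrite !mxE; case: eqVneq => [<-|ij]; last first.
  by rewrite mulr0n addr0 Q0.
rewrite mulr1n lerDl c0; split => //.
have : `|Q i i| <= c by rewrite /c (bigD1 i)//= lerDl sumr_ge0.
by have := lerNnormlW (lexx `|Q i i|); lra.
Qed.

Lemma expmx_rate_ge0 (R : realType) n (Q : 'M[R]_n) t i j :
  is_rate_matrix Q -> 0 <= t -> 0 <= expmx (t *: Q) i j.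
Proof.
move=> /rate_matrix_uniformize[c [N -> N0]] t0.
rewrite expmx_shift mxE mulr_ge0 ?expR_ge0//.
apply: le_trans (@expmx_term_le _ _ N t 0 i j (fun i j => (N0 i j).1) t0).
by rewrite !expr0 mul1r mxE fact0 invr1 mul1r; case: eqP.
Qed.

Lemma expmx_rate_gt0 (R : realType) n (Q : 'M[R]_n) t i j :
  is_rate_matrix Q -> connect [rel x y | 0 < Q x y] i j -> 0 < t ->
  0 < expmx (t *: Q) i j.
Proof.
move=> /rate_matrix_uniformize[c [N -> N0]] ij t0.
rewrite expmx_shift mxE mulr_gt0 ?expR_gt0//.
(* [k] is the number of edges of a path from [i] to [j]. *)
suff [k Nk] : exists k, 0 < (N ^+ k) i j.
  apply: lt_le_trans (@expmx_term_le _ _ N t k i j (fun i j => (N0 i j).1) (ltW t0)).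
  by rewrite !mulr_gt0 ?exprn_gt0 ?invr_gt0 ?ltr0n ?fact_gt0.
have Nk0 l x y : 0 <= (N ^+ l) x y.
  elim: l x y => [|l IHl] x y; first by rewrite expr0 mxE; case: eqP.
  by rewrite exprS -mulmxE mxE sumr_ge0// => z _; rewrite mulr_ge0// (N0 _ _).1.
case/connectP: ij => p; elim: p i => [|y p IHp] i /=.
  by move=> _ ->; exists 0%N; rewrite expr0 mxE eqxx.
move=> /andP[iy /IHp/[apply] -[k Nk]]; exists k.+1.
rewrite exprS -mulmxE mxE (bigD1 y)//= ltr_wpDr//.
  by apply: sumr_ge0 => z _; rewrite mulr_ge0// (N0 _ _).1.
by rewrite mulr_gt0// (lt_le_trans _ (N0 i y).2).
Qed.

Lemma rate_matrix_mul1 (R : realType) n (Q : 'M[R]_n) :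
  is_rate_matrix Q -> Q *m const_mx 1 = 0 :> 'cV_n.
Proof.
case=> _ Q1; apply/matrixP => i j; rewrite !mxE -[RHS](Q1 i).
by apply: eq_bigr => k _; rewrite mxE mulr1.
Qed.

Lemma expmx_rate_mul1 (R : realType) n (Q : 'M[R]_n) t :
  is_rate_matrix Q -> expmx (t *: Q) *m const_mx 1 = const_mx 1 :> 'cV_n.
Proof.
move=> Qrate; rewrite -(@expmx_unique _ _ _ _ (fun=> const_mx 1))// => s.
by rewrite rate_matrix_mul1//; exact: mx_derive_cst.
Qed.

Lemma expmx_rate_sum1 (R : realType) n (Q : 'M[R]_n) t i :
  is_rate_matrix Q -> \sum_j expmx (t *: Q) i j = 1.
Proof.
move=> /(expmx_rate_mul1 t)/matrixP/(_ i 0); rewrite mxE [RHS]mxE => <-.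
by apply: eq_bigr => k _; rewrite [const_mx _ _ _]mxE mulr1.
Qed.

(* s |-> exp ((t - s) Q) F(s) is nondecreasing. *)
Lemma expmx_supersolution (R : realType) n (Q : 'M[R]_n) (F dF : R -> 'cV[R]_n) (t : R) :
  is_rate_matrix Q -> 0 <= t ->
  (forall s : R, mx_derive F s (dF s)) ->
  (forall (s : R) i, 0 <= s <= t -> (Q *m F s) i 0 <= dF s i 0) ->
  forall i, (expmx (t *: Q) *m F 0) i 0 <= F t i 0.
Proof.
move=> Qrate t0 dFs super i.
pose H s : R := (expmx ((t - s) *: Q) *m F s) i 0.
have H' (s : R) : is_derive s (1 : R) H ((expmx ((t - s) *: Q) *m (dF s - Q *m F s)) i 0).
  exact: (mx_derive_expmx_rev Q t (dFs s) i 0).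
have -> : F t i 0 = H t by rewrite /H subrr scale0r expmx0 mul1mx.
have -> : (expmx (t *: Q) *m F 0) i 0 = H 0 by rewrite /H subr0.
have dH (s : R) : derivable H s 1 by case: (H' s).
apply: (@ger0_derive1_ndecr _ H 0 t) => //.
- move=> s; rewrite in_itv /= => /andP[s0 st].
  rewrite derive1E; have -> := @derive_val _ _ _ _ _ _ _ (H' s).
  rewrite mxE sumr_ge0// => j _; rewrite mulr_ge0//.
    by rewrite expmx_rate_ge0// subr_ge0 ltW.
  by rewrite !mxE subr_ge0; have := super s j; rewrite mxE; apply; rewrite !ltW.
- apply: continuous_subspaceT => s; apply: differentiable_continuous.
  by apply/derivable1_diffP.
Qed.

(** * Bounds for a fixed rate matrix *)

Lemma mxDE (R : nmodType) m n (A B : 'M[R]_(m, n)) i j :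
  (A + B) i j = A i j + B i j.
Proof. by rewrite mxE. Qed.

Lemma mxZE (R : pzRingType) m n c (A : 'M[R]_(m, n)) i j :
  (c *: A) i j = c * A i j.
Proof. by rewrite mxE. Qed.

Lemma mxNE (R : zmodType) m n (A : 'M[R]_(m, n)) i j : (- A) i j = - A i j.
Proof. by rewrite mxE. Qed.

Lemma const_mxE (R : Type) m n (c : R) i j : (const_mx c : 'M[R]_(m, n)) i j = c.
Proof. by rewrite mxE. Qed.

Lemma expmx_rate_le (R : realType) n (Q : 'M[R]_n) t (u : 'cV[R]_n) c :
  is_rate_matrix Q -> 0 <= t -> (forall j, u j 0 <= c) ->
  forall i, (expmx (t *: Q) *m u) i 0 <= c.
Proof.
move=> Qrate t0 uc i; rewrite mxE -[leRHS]mul1r -(expmx_rate_sum1 t i Qrate) mulr_suml.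
by apply: ler_sum => j _; rewrite ler_wpM2l ?expmx_rate_ge0.
Qed.

Lemma expmx_rate_ge (R : realType) n (Q : 'M[R]_n) t (u : 'cV[R]_n) c :
  is_rate_matrix Q -> 0 <= t -> (forall j, c <= u j 0) ->
  forall i, c <= (expmx (t *: Q) *m u) i 0.
Proof.
move=> Qrate t0 uc i; rewrite mxE -[leLHS]mul1r -(expmx_rate_sum1 t i Qrate) mulr_suml.
by apply: ler_sum => j _; rewrite ler_wpM2l ?expmx_rate_ge0.
Qed.

(* Supersolution: J exp (s G) v + eps (z + C s). *)
Lemma expmx_intertwine_le (R : realType) n m (Q : 'M[R]_n) (G : 'M[R]_m)
    (J : 'M[R]_(n, m)) (d z : 'cV[R]_n) (eps C t : R) (v : 'cV[R]_m) :
  is_rate_matrix Q -> is_rate_matrix G -> 0 <= eps -> 0 <= t ->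
  (forall i, 0 <= z i 0) -> (forall i, d i 0 <= C - (Q *m z) i 0) ->
  (forall i, \sum_j `|(Q *m J - J *m G) i j| <= eps * d i 0) ->
  (forall j, `|v j 0| <= 1) ->
  forall i, (expmx (t *: Q) *m (J *m v)) i 0 <=
            (J *m (expmx (t *: G) *m v)) i 0 + eps * (z i 0 + C * t).
Proof.
move=> Qrate Grate eps0 t0 z0 dz QJ v1 i.
pose w s : 'cV_m := expmx (s *: G) *m v.
pose F s : 'cV_n := J *m w s + (eps *: z + (eps * C * s) *: const_mx 1).
pose dF s : 'cV_n := J *m (G *m w s) + (eps * C) *: const_mx 1.
have dFs s : mx_derive F s (dF s).
  apply: mx_derive_add.
    have := mx_derive_mul (mx_derive_cst J s)
      (mx_derive_mul (mx_derive_expmx G s) (mx_derive_cst v s)).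
    by rewrite mul0mx add0r mulmx0 addr0 -mulmxA.
  rewrite -[X in mx_derive _ _ X]add0r; apply: mx_derive_add.
    exact: mx_derive_cst.
  apply: (@mx_derive_scale _ _ _ (fun r => eps * C * r)).
  have := @is_deriveZ _ _ _ (fun r : R => r) (eps * C) s (1 : R) _ (is_derive_id s (1 : R)).
  by rewrite /GRing.scale /= mulr1.
have w1 s j : 0 <= s -> `|w s j 0| <= 1.
  move=> s0; rewrite ler_norml; apply/andP; split.
    by apply: expmx_rate_ge => // k; have := v1 k; rewrite ler_norml => /andP[].
  by apply: expmx_rate_le => // k; have := v1 k; rewrite ler_norml => /andP[].
have super (s : R) k : 0 <= s <= t -> (Q *m F s) k 0 <= dF s k 0.
  move=> /andP[s0 _].
  have -> : (Q *m F s) k 0 =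
      ((Q *m J - J *m G) *m w s) k 0 + (J *m (G *m w s)) k 0 + eps * (Q *m z) k 0.
    rewrite /F !mulmxDr -!scalemxAr rate_matrix_mul1// scaler0 addr0.
    by rewrite mulmxBl !mulmxA !mxDE mxNE mxZE subrK.
  rewrite /dF mxDE mxZE const_mxE mulr1.
  (* As [w] stays in [-1, 1], the intertwining defect costs at most [eps * d], which the drift of
     [eps (z + C s)] absorbs. *)
  have : ((Q *m J - J *m G) *m w s) k 0 <= eps * d k 0.
    apply: le_trans (QJ k); rewrite mxE; apply: ler_sum => j _.
    apply: le_trans (ler_norm _) _; rewrite normrM -[leRHS]mulr1.
    by rewrite ler_wpM2l// w1.
  by have := ler_wpM2l eps0 (dz k); lra.
have := expmx_supersolution Qrate t0 dFs super i.
have Qz0 : 0 <= (expmx (t *: Q) *m (eps *: z)) i 0.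
  by apply: expmx_rate_ge => // j; rewrite mxZE mulr_ge0.
rewrite {1}/F mulr0 scale0r addr0 /w scale0r expmx0 mul1mx mulmxDr mxDE.
by rewrite /F !mxDE !mxZE const_mxE -/(w t); lra.
Qed.

(** The lower bound is the one-sided estimate applied to [- v]. *)
Lemma expmx_intertwine (R : realType) n m (Q : 'M[R]_n) (G : 'M[R]_m)
    (J : 'M[R]_(n, m)) (d z : 'cV[R]_n) (eps C t : R) (v : 'cV[R]_m) :
  is_rate_matrix Q -> is_rate_matrix G -> 0 <= eps -> 0 <= t ->
  (forall i, 0 <= z i 0) -> (forall i, d i 0 <= C - (Q *m z) i 0) ->
  (forall i, \sum_j `|(Q *m J - J *m G) i j| <= eps * d i 0) ->
  (forall j, `|v j 0| <= 1) ->
  forall i, `|(expmx (t *: Q) *m (J *m v)) i 0 - (J *m (expmx (t *: G) *m v)) i 0| <=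
            eps * (z i 0 + C * t).
Proof.
move=> Qrate Grate eps0 t0 z0 dz QJ v1 i.
have H1 := expmx_intertwine_le Qrate Grate eps0 t0 z0 dz QJ v1 i.
have v1' j : `|(- v) j 0| <= 1 by rewrite mxE normrN.
have := expmx_intertwine_le Qrate Grate eps0 t0 z0 dz QJ v1' i.
rewrite !mulmxN !mxNE.
rewrite ler_norml; lra.
Qed.

(* Supersolution on [0, delta]:
   (1 - s / delta) ind + (eps / delta) (z + C s) + C s. *)
Lemma expmx_fast_mass (R : realType) n (Q : 'M[R]_n) (d z ind : 'cV[R]_n)
    (eps C Z delta t : R) :
  is_rate_matrix Q -> 0 <= eps -> 0 <= C -> 0 < delta -> delta <= t ->
  (forall i, 0 <= z i 0 <= Z) -> (forall i, d i 0 <= C - (Q *m z) i 0) ->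
  (forall i, ind i 0 <= eps * d i 0) -> (forall i, (Q *m ind) i 0 <= C) ->
  forall i, (expmx (t *: Q) *m ind) i 0 <= eps * Z / delta + eps * C + C * delta.
Proof.
move=> Qrate eps0 C0 delta0 dt z0 dz indd Qind i.
(* Only the last [delta] units of time matter: exp((t - delta)Q) averages, so a bound at time
   [delta], uniform in the starting state, suffices. *)
have -> : t = (t - delta) + delta by rewrite subrK.
rewrite expmxD -mulmxA; apply: expmx_rate_le => // [|{i}i]; first by rewrite subr_ge0.
(* The first summand pays for the drift of [(eps / delta) z], the second for
   [(1 - s / delta) Q ind <= C]. *)
pose c := eps / delta * C + C.
pose F s : 'cV_n := ind + ((- delta^-1 * s) *: ind +
  ((eps / delta) *: z + (c * s) *: const_mx 1)).
pose dF (s : R) : 'cV_n := - delta^-1 *: ind + c *: const_mx 1.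
have dlin (k s : R) : is_derive s (1 : R) (fun r => k * r) k.
  have := @is_deriveZ _ _ _ (fun r : R => r) k s (1 : R) _ (is_derive_id s (1 : R)).
  by rewrite /GRing.scale /= mulr1.
have dFs s : mx_derive F s (dF s).
  rewrite /dF -[X in mx_derive _ _ X]add0r; apply: mx_derive_add.
    exact: mx_derive_cst.
  apply: mx_derive_add; first exact: mx_derive_scale.
  rewrite -[X in mx_derive _ _ X]add0r; apply: mx_derive_add.
    exact: mx_derive_cst.
  exact: mx_derive_scale.
have super (s : R) k : 0 <= s <= delta -> (Q *m F s) k 0 <= dF s k 0.
  move=> /andP[s0 sd].
  have -> : (Q *m F s) k 0 =
      (1 - s / delta) * (Q *m ind) k 0 + eps / delta * (Q *m z) k 0.
    rewrite /F !mulmxDr -!scalemxAr rate_matrix_mul1// scaler0 addr0.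
    rewrite !mxDE !mxZE; ring.
  have -> : dF s k 0 = - delta^-1 * ind k 0 + c.
    by rewrite /dF mxDE !mxZE const_mxE mulr1.
  have s1 : 0 <= 1 - s / delta <= 1.
    by rewrite subr_ge0 ler_pdivrMr// mul1r sd /= gerBl divr_ge0 ?(ltW delta0).
  have H1 : (1 - s / delta) * (Q *m ind) k 0 <= C.
    case/andP: s1 => s1 s2.
    apply: le_trans (ler_wpM2l s1 (Qind k)) _.
    by rewrite -[leRHS]mul1r ler_wpM2r.
  have di0 : 0 <= delta^-1 by rewrite invr_ge0 ltW.
  have H2 := ler_wpM2l (mulr_ge0 eps0 di0) (dz k).
  have H3 := ler_wpM2l di0 (indd k).
  rewrite /c; lra.
have := expmx_supersolution Qrate (ltW delta0) dFs super i.
rewrite {1}/F !mulr0 !scale0r add0r addr0 mulmxDr mxDE.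
have : 0 <= (expmx (delta *: Q) *m ((eps / delta) *: z)) i 0.
  apply: expmx_rate_ge => // [|j]; first exact: ltW.
  by rewrite mxE mulr_ge0 ?divr_ge0 ?(ltW delta0)//; case/andP: (z0 j).
(* At [s = delta] the coefficient of [ind] vanishes, so only small terms remain. *)
have -> : F delta i 0 = eps / delta * z i 0 + c * delta.
  by rewrite /F !mxDE !mxZE const_mxE mulNr mulVf ?gt_eqF// mulr1; ring.
have : eps / delta * z i 0 <= eps / delta * Z.
  by rewrite ler_wpM2l ?divr_ge0 ?(ltW delta0)//; case/andP: (z0 i).
have -> : c * delta = eps * C + C * delta by rewrite /c; field; rewrite gt_eqF.
by rewrite [eps * Z / delta]mulrAC; lra.
Qed.

(** * Uniformity in time *)

Definition is_stochastic (R : realType) m n (M : 'M[R]_(m, n)) : Prop :=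
  (forall i j, 0 <= M i j) /\ (forall i, \sum_j M i j = 1).

Lemma stochastic_mul (R : realType) m n p (M : 'M[R]_(m, n)) (N : 'M[R]_(n, p)) :
  is_stochastic M -> is_stochastic N -> is_stochastic (M *m N).
Proof.
move=> [M0 M1] [N0 N1]; split=> i.
  by move=> j; rewrite mxE sumr_ge0// => k _; rewrite mulr_ge0.
under eq_bigr do rewrite mxE; rewrite exchange_big /= -[RHS](M1 i).
by apply: eq_bigr => k _; rewrite -mulr_sumr N1 mulr1.
Qed.

Lemma stochastic_expmx (R : realType) n (Q : 'M[R]_n) t :
  is_rate_matrix Q -> 0 <= t -> is_stochastic (expmx (t *: Q)).
Proof.
by move=> Qrate t0; split=> i *; [exact: expmx_rate_ge0|exact: expmx_rate_sum1].
Qed.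

(** The matrix [J]. With [K] the absorption matrix, it extends a function on the slow states to one
    that is harmonic at the fast states for the limiting jump chain. *)
Definition slow_lift (R : realType) a b (K : 'M[R]_(a, b)) : 'M[R]_(a + b, b) :=
  col_mx K 1%:M.

(* A chain started in a fast state jumps at once to a slow state drawn from K,
   then follows exp (t G). *)
Definition reduced_kernel (R : realType) a b (K : 'M[R]_(a, b)) (G : 'M[R]_b) t :
    'M[R]_(a + b) :=
  row_mx 0 (slow_lift K *m expmx (t *: G)).

Lemma stochastic_slow_lift (R : realType) a b (K : 'M[R]_(a, b)) :
  is_stochastic K -> is_stochastic (slow_lift K).
Proof.
move=> [K0 K1]; split=> i; case: (split_ordP i) => k ->.
- by move=> j; rewrite col_mxEu.
- by move=> j; rewrite col_mxEd mxE; case: eqP.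
- by under eq_bigr do rewrite col_mxEu.
under eq_bigr do rewrite col_mxEd mxE.
rewrite (bigD1 k)//= eqxx big1 ?addr0// => j /negPf jk.
by rewrite eq_sym jk.
Qed.

Lemma stochastic_reduced_kernel (R : realType) a b (K : 'M[R]_(a, b)) (G : 'M[R]_b) t :
  is_stochastic K -> is_rate_matrix G -> 0 <= t ->
  is_stochastic (reduced_kernel K G t).
Proof.
move=> Kst Grate t0.
have [S0 S1] := stochastic_mul (stochastic_slow_lift Kst) (stochastic_expmx Grate t0).
split=> i.
  move=> j; case: (split_ordP j) => k ->; first by rewrite row_mxEl mxE.
  by rewrite row_mxEr.
rewrite big_split_ord /= big1 ?add0r; last by move=> j _; rewrite row_mxEl mxE.
by rewrite -(S1 i); apply: eq_bigr => j _; rewrite row_mxEr.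
Qed.

(** The zero columns of the left factor discard the fast rows of the right one, and the slow rows of
    [J] form the identity. *)
Lemma reduced_kernelD (R : realType) a b (K : 'M[R]_(a, b)) (G : 'M[R]_b) s t :
  reduced_kernel K G (s + t) = reduced_kernel K G s *m reduced_kernel K G t.
Proof.
rewrite /reduced_kernel mul_mx_row mulmx0 /slow_lift.
by rewrite mulmxA mul_row_col mul0mx add0r mulmx1 expmxD mulmxA.
Qed.

(** Doeblin's argument: since [x] has total mass 0, subtracting [c j] from column [j] leaves [x M]
    unchanged, and what remains is nonnegative with row sums [1 - \sum_j c j]. *)
Lemma zero_sum_contraction (R : realType) n (x : 'rV[R]_n) (M : 'M[R]_n) (c : 'I_n -> R) :
  \sum_j x 0 j = 0 -> (forall i, \sum_j M i j = 1) -> (forall i j, c j <= M i j) ->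
  \sum_j `|(x *m M) 0 j| <= (1 - \sum_j c j) * \sum_j `|x 0 j|.
Proof.
move=> x0 M1 cM.
have -> : (1 - \sum_j c j) * \sum_j `|x 0 j| =
    \sum_j \sum_i `|x 0 i| * (M i j - c j).
  rewrite exchange_big /= mulrC mulr_suml; apply: eq_bigr => i _.
  by rewrite -mulr_sumr sumrB M1.
apply: ler_sum => j _.
have -> : (x *m M) 0 j = \sum_i x 0 i * (M i j - c j).
  rewrite mxE; under [RHS]eq_bigr do rewrite mulrBr.
  by rewrite sumrB -mulr_suml x0 mul0r subr0.
apply: le_trans (ler_norm_sum _ _ _) _; apply: ler_sum => i _.
by rewrite normrM ler_wpM2l// ger0_norm// subr_ge0.
Qed.

Lemma semigroup_dist_uniform (R : realType) n (P S : R -> 'M[R]_n) (h err : R)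
    (c : 'I_n -> R) :
  0 < h -> 0 <= err ->
  (forall s t, P (s + t) = P s *m P t) -> (forall s t, S (s + t) = S s *m S t) ->
  (forall t, 0 <= t -> is_stochastic (P t)) ->
  (forall t, 0 <= t -> is_stochastic (S t)) ->
  0 < \sum_j c j -> (forall i j, c j <= S h i j) ->
  (forall t i, h <= t <= 2 * h -> \sum_j `|P t i j - S t i j| <= err) ->
  forall t i, h <= t -> \sum_j `|P t i j - S t i j| <= err / \sum_j c j.
Proof.
move=> h0 err0 PD SD Pst Sst; set alpha := \sum_j c j => alpha0 cS short t i ht.
have alpha1 : alpha <= 1.
  by rewrite -((Sst h (ltW h0)).2 i); apply: ler_sum.
have errle : err <= err / alpha by rewrite ler_pdivlMr// ler_piMr// ltW.
(* Induction backwards by steps of [h]; the offset 2 makes the base case the interval [h, 2h]. *)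
have [k] : exists k : nat, t <= k.+2%:R * h.
  exists (Num.trunc (t / h)).+1; rewrite -ler_pdivrMr//.
  by apply/ltW/(lt_trans (truncnS_gt _)); rewrite ltr_nat.
elim: k t i ht => [|k IHk] t i ht tk.
  by apply: le_trans errle; apply: short; rewrite ht.
have [t2|t2] := leP t (2 * h).
  by apply: le_trans errle; apply: short; rewrite ht.
pose u := t - h.
have hu : h <= u by rewrite /u; lra.
have u0 : 0 <= u by apply: le_trans hu; exact: ltW.
have tE : t = u + h by rewrite /u subrK.
have {}IHk : \sum_j `|P u i j - S u i j| <= err / alpha.
  by apply: IHk => //; move: tk; rewrite /u -[in k.+3%:R]natr1 mulrDl mul1r; lra.
pose x : 'rV_n := row i (P u - S u).
have xE j : x 0 j = P u i j - S u i j by rewrite !mxE.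
have x0 : \sum_j x 0 j = 0.
  under eq_bigr do rewrite xE.
  by rewrite sumrB (Pst _ u0).2 (Sst _ u0).2 subrr.
(* [P_(u+h) - S_(u+h) = (P_u - S_u) S_h + P_u (P_h - S_h)]: the old error is contracted and a fresh
   error of at most [err] is added. *)
have decomp j : P t i j - S t i j =
    (x *m S h) 0 j + \sum_k P u i k * (P h k j - S h k j).
  rewrite tE PD SD.
  have -> : \sum_k P u i k * (P h k j - S h k j) = (P u *m (P h - S h)) i j.
    by rewrite mxE; apply: eq_bigr => l _; rewrite !mxE.
  rewrite /x -row_mul [in RHS]mxE -mxDE mulmxBl mulmxBr.
  by rewrite -mxNE -mxDE; congr (fun_of_matrix _ i j); rewrite [RHS]addrC [RHS]addrA subrK.
apply: (@le_trans _ _ (\sum_j `|(x *m S h) 0 j| +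
    \sum_j \sum_k P u i k * `|P h k j - S h k j|)).
  rewrite -big_split /=; apply: ler_sum => j _; rewrite decomp.
  apply: le_trans (ler_normD _ _) _; rewrite lerD2l.
  apply: le_trans (ler_norm_sum _ _ _) _; apply: ler_sum => l _.
  by rewrite normrM ger0_norm// (Pst _ u0).1.
have H1 := zero_sum_contraction x0 (Sst h (ltW h0)).2 cS.
have H2 : \sum_j \sum_k P u i k * `|P h k j - S h k j| <= err.
  rewrite exchange_big /= -[leRHS]mul1r -((Pst u u0).2 i) mulr_suml.
  apply: ler_sum => l _; rewrite -mulr_sumr ler_wpM2l ?(Pst _ u0).1//.
  by apply: short; rewrite lexx /=; lra.
have H3 : \sum_j `|x 0 j| <= err / alpha by under eq_bigr do rewrite xE.
have H4 : (1 - alpha) * \sum_j `|x 0 j| <= (1 - alpha) * (err / alpha).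
  by rewrite ler_wpM2l// subr_ge0.
(* [err / alpha] is the fixed point of [e |-> (1 - alpha) e + err]. *)
have H5 : (1 - alpha) * (err / alpha) + err = err / alpha.
  by field; rewrite gt_eqF.
by rewrite -H5; apply: lerD => //; apply: le_trans H1 H4.
Qed.

(** * Distance from the transition function to the reduced kernel *)

Definition fast_indicator (R : realType) a b : 'cV[R]_(a + b) :=
  col_mx (const_mx 1) 0.

Lemma stochastic_le1 (R : realType) m n (M : 'M[R]_(m, n)) i j :
  is_stochastic M -> M i j <= 1.
Proof.
by move=> [M0 M1]; rewrite -(M1 i) (bigD1 j)//= lerDl sumr_ge0.
Qed.

(** The fast columns contribute the fast mass. For a slow column [j], intertwining tested on the
    basis vector [e_j] compares the kernel with [(P J) i j], which differs from [P i j] by at most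
    the fast mass. Hence the factor [1 + b]. *)
Lemma reduced_kernel_dist (R : realType) a b (Q : 'M[R]_(a + b)) (G : 'M[R]_b)
    (K : 'M[R]_(a, b)) (d z : 'cV[R]_(a + b)) (eps C Z delta t : R) :
  is_rate_matrix Q -> is_rate_matrix G -> is_stochastic K ->
  0 <= eps -> 0 <= C -> 0 < delta -> delta <= t ->
  (forall i, 0 <= z i 0 <= Z) -> (forall i, d i 0 <= C - (Q *m z) i 0) ->
  (forall i, fast_indicator R a b i 0 <= eps * d i 0) ->
  (forall i, (Q *m fast_indicator R a b) i 0 <= C) ->
  (forall i, \sum_j `|(Q *m slow_lift K - slow_lift K *m G) i j| <= eps * d i 0) ->
  forall i, \sum_j `|expmx (t *: Q) i j - reduced_kernel K G t i j| <=
    (1 + b%:R) * (eps * Z / delta + eps * C + C * delta) + b%:R * (eps * (Z + C * t)).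
Proof.
move=> Qrate Grate Kst eps0 C0 delta0 dt zZ dz indd Qind QJ i.
have t0 : 0 <= t by apply: le_trans dt; exact: ltW.
set mass := eps * Z / delta + _ + _; set err := eps * (Z + _).
have [P0 _] := stochastic_expmx Qrate t0.
have massP := expmx_fast_mass Qrate eps0 C0 delta0 dt zZ dz indd Qind i.
set P := expmx (t *: Q) in P0 massP *.
have massE : (P *m fast_indicator R a b) i 0 = \sum_(j < a) P i (lshift b j).
  rewrite mxE big_split_ord /= [X in _ + X]big1 ?addr0; last first.
    by move=> j _; rewrite col_mxEd [X in _ * X]mxE mulr0.
  by apply: eq_bigr => j _; rewrite col_mxEu [X in _ * X]mxE mulr1.
rewrite massE -/mass in massP.
have -> : (1 + b%:R) * mass + b%:R * err = mass + \sum_(j < b) (mass + err).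
  by rewrite sumr_const card_ord -[in RHS]mulr_natl; ring.
rewrite big_split_ord /=; apply: lerD.
  apply: le_trans massP; apply: ler_sum => j _.
  by rewrite row_mxEl [X in _ - X]mxE subr0 ger0_norm.
apply: ler_sum => j _; rewrite row_mxEr.
have v1 k : `|(delta_mx j 0 : 'cV[R]_b) k 0| <= 1.
  by rewrite mxE; case: (_ && _); rewrite ?normr1 ?normr0.
have z0 k : 0 <= z k 0 by case/andP: (zZ k).
have := expmx_intertwine Qrate Grate eps0 t0 z0 dz QJ v1 i.
rewrite !mulmxA -!colE [X in X - _]mxE [X in _ - X]mxE -/P.
have -> : (P *m slow_lift K) i j = \sum_(k < a) P i (lshift b k) * K k j + P i (rshift a j).
  rewrite mxE big_split_ord /=; congr (_ + _).
    by apply: eq_bigr => k _; rewrite col_mxEu.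
  rewrite (bigD1 j)//= big1 ?addr0; last first.
    by move=> k /negPf kj; rewrite col_mxEd [X in _ * X]mxE kj mulr0.
  by rewrite col_mxEd [X in _ * X]mxE eqxx mulr1.
have H0 : 0 <= \sum_(k < a) P i (lshift b k) * K k j.
  by apply: sumr_ge0 => k _; rewrite mulr_ge0// Kst.1.
have H1 : \sum_(k < a) P i (lshift b k) * K k j <= mass.
  apply: le_trans massP; apply: ler_sum => k _.
  by rewrite -[leRHS]mulr1 ler_wpM2l// stochastic_le1.
have H2 : eps * (z i 0 + C * t) <= err.
  by rewrite ler_wpM2l// lerD2r; case/andP: (zZ i).
rewrite !ler_norml; lra.
Qed.

(** For [h > 0] irreducibility makes all entries of exp(hG) positive, and their minimum survives
    averaging by the rows of [J]. Fast columns vanish, so they get [c = 0]. *)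
Lemma reduced_kernel_minor (R : realType) a b (K : 'M[R]_(a, b)) (G : 'M[R]_b) h :
  (0 < b)%N -> is_stochastic K -> is_rate_matrix G -> irreducible_rates G -> 0 < h ->
  exists2 c : 'I_(a + b) -> R, 0 < \sum_j c j &
    forall i j, c j <= reduced_kernel K G h i j.
Proof.
move=> b0 Kst Grate Girr h0.
pose e := \big[Order.min/1]_(p : 'I_b * 'I_b) expmx (h *: G) p.1 p.2.
have e0 : 0 < e by apply: lt_bigmin => // -[i j] _; exact: expmx_rate_gt0.
exists (fun j => if (j < a)%N then 0 else e).
  rewrite big_split_ord /= big1 ?add0r; last by move=> j _; rewrite ltn_ord.
  under eq_bigr do rewrite ltnNge leq_addr.
  by rewrite sumr_const card_ord pmulrn_lgt0.
move=> i j; case: (split_ordP j) => k ->.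
  by rewrite row_mxEl mxE.
rewrite row_mxEr mxE.
have [J0 J1] := stochastic_slow_lift Kst.
rewrite -[leLHS]mul1r -(J1 i) mulr_suml; apply: ler_sum => l _.
rewrite ler_wpM2l//.
exact: (bigmin_le _ (l, k)).
Qed.

Lemma reduced_kernel_cvg (R : realType) a b (Q : R -> 'M[R]_(a + b)) (G : 'M[R]_b)
    (K : 'M[R]_(a, b)) (z : 'cV[R]_(a + b)) (C Z h : R) :
  (0 < b)%N -> (forall l, 0 < l -> is_rate_matrix (Q l)) ->
  is_rate_matrix G -> irreducible_rates G -> is_stochastic K ->
  0 <= C -> 0 < h -> (forall i, 0 <= z i 0 <= Z) ->
  (\forall l \near +oo, forall i, (Q l *m fast_indicator R a b) i 0 <= C) ->
  (forall eps, 0 < eps -> \forall l \near +oo, forall i, exists2 d,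
     d <= C - (Q l *m z) i 0 /\ fast_indicator R a b i 0 <= eps * d &
     \sum_j `|(Q l *m slow_lift K - slow_lift K *m G) i j| <= eps * d) ->
  forall err, 0 < err -> \forall l \near +oo, forall t i, h <= t ->
    \sum_j `|expmx (t *: Q l) i j - reduced_kernel K G t i j| <= err.
Proof.
move=> b0 Qrate Grate Girr Kst C0 h0 zZ Qind Qd err err0.
have [c alpha0 cS] := reduced_kernel_minor b0 Kst Grate Girr h0.
have Z0 : 0 <= Z.
  by case/andP: (zZ (rshift a (Ordinal b0))); exact: le_trans.
set alpha := \sum_j c j in alpha0.
(* The passage from [h, 2h] to all later times costs a factor [1 / alpha]. *)
pose e := err * alpha.
have e0 : 0 < e by rewrite mulr_gt0.
(* [delta] is fixed before [eps], since [eps * Z / delta] must become small afterwards; [1 + C]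
   avoids dividing by 0 when [C = 0]. *)
have [delta [delta0 deltah Cdelta]] : exists delta : R,
    [/\ 0 < delta, delta <= h & (1 + b%:R) * (C * delta) <= e / 2].
  have D0 : 0 < 2 * (1 + b%:R) * (1 + C) :> R.
    by rewrite !mulr_gt0// ltr_wpDr.
  exists (Num.min h (e / (2 * (1 + b%:R) * (1 + C)))); split.
  - by rewrite lt_min h0 divr_gt0.
  - by rewrite ge_min lexx.
  - apply: (@le_trans _ _ ((1 + b%:R) * ((1 + C) * (e / (2 * (1 + b%:R) * (1 + C)))))).
      rewrite ler_wpM2l ?addr_ge0// ler_pM//; first by rewrite le_min !ltW// divr_gt0.
        by rewrite lerDr.
      by rewrite ge_min lexx orbT.
    have C1 : 1 + C != 0 by rewrite gt_eqF// ltr_wpDr.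
    have b1 : 1 + b%:R != 0 :> R by rewrite gt_eqF// ltr_wpDr.
    rewrite le_eqVlt; apply/orP; left; apply/eqP; field.
    by rewrite b1 C1.
(* [D] collects the coefficients of [eps] in the bound of [reduced_kernel_dist], taken at the worst
   time [2 * h]. *)
pose D := (1 + b%:R) * (Z / delta + C) + b%:R * (Z + C * (2 * h)).
have D0 : 0 <= D.
  rewrite /D addr_ge0 ?mulr_ge0 ?addr_ge0 ?divr_ge0 ?(ltW delta0)//.
  by rewrite !mulr_ge0 ?(ltW h0).
pose eps := e / (2 * (1 + D)).
have D1 : 0 < 1 + D by rewrite ltr_wpDr.
have eps0 : 0 < eps by rewrite divr_gt0// mulr_gt0.
have epsD : eps * D <= e / 2.
  have -> : e / 2 = eps * (1 + D) by rewrite /eps; field; rewrite gt_eqF.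
  by rewrite ler_wpM2l ?(ltW eps0)// lerDr.
near=> l.
have l0 : 0 < l by near: l; exact: nbhs_pinfty_gt.
have Qindl : forall i, (Q l *m fast_indicator R a b) i 0 <= C by near: l.
have Qdl : forall i, exists2 d,
     d <= C - (Q l *m z) i 0 /\ fast_indicator R a b i 0 <= eps * d &
     \sum_j `|(Q l *m slow_lift K - slow_lift K *m G) i j| <= eps * d.
  by near: l; exact: Qd eps eps0.
pose d : 'cV_(a + b) := \col_i s2val (cid2 (Qdl i)).
have dE i : d i 0 = s2val (cid2 (Qdl i)) by rewrite mxE.
have dz i : d i 0 <= C - (Q l *m z) i 0 by rewrite dE; case: cid2 => ? [].
have indd i : fast_indicator R a b i 0 <= eps * d i 0 by rewrite dE; case: cid2 => ? [].
have QJ i : \sum_j `|(Q l *m slow_lift K - slow_lift K *m G) i j| <= eps * d i 0.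
  by rewrite dE; case: cid2.
have short t i : h <= t <= 2 * h ->
    \sum_j `|expmx (t *: Q l) i j - reduced_kernel K G t i j| <= e.
  move=> /andP[ht th].
  apply: le_trans (reduced_kernel_dist (Qrate l l0) Grate Kst (ltW eps0) C0 delta0
    (le_trans deltah ht) zZ dz indd Qindl QJ i) _.
  have H1 : b%:R * (eps * (Z + C * t)) <= b%:R * (eps * (Z + C * (2 * h))).
    by rewrite ler_wpM2l// ler_wpM2l ?(ltW eps0)// lerD2l ler_wpM2l.
  apply: le_trans (lerD (lexx _) H1) _.
  have -> : e = e / 2 + e / 2 by lra.
  apply: le_trans (lerD epsD Cdelta).
  rewrite le_eqVlt; apply/orP; left; apply/eqP; rewrite /D; ring.
move=> t i ht.
have errE : err = e / alpha by rewrite /e mulfK// gt_eqF.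
rewrite errE.
apply: (@semigroup_dist_uniform _ _ (fun t => expmx (t *: Q l)) (reduced_kernel K G) h e c) => //.
- exact: ltW.
- by move=> *; exact: expmxD.
- by move=> *; exact: reduced_kernelD.
- by move=> *; apply: stochastic_expmx => //; exact: Qrate.
- by move=> *; exact: stochastic_reduced_kernel.
Unshelve. all: by end_near.
Qed.

(** * Absorption of the jump chain *)

Lemma hitting_time_lty (R : realType) (T S : Type) (eta : nat -> T -> S) (B : pred S) :
  [set w | (hitting_time R eta B w < +oo)%E] = \bigcup_m [set w | B (eta m w)].
Proof.
apply/seteqP; split=> w /=.
  by move=> /ereal_inf_lt[_ [m Bm <-] _]; exists m.
move=> [m _ Bm]; apply: (@le_lt_trans _ _ (m%:R)%:E); last exact: ltry.
by apply: ereal_inf_lbound; exists m.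
Qed.

(** Hitting [B] is a countable union of cylinders over finite words ending in [B]. If no state of
    [B] were reachable, each such word would contain a zero factor, and the event would be null. *)
Lemma dtmc_hit_connect d (T : measurableType d) (R : realType) n
    (P : probability T R) (eta : nat -> T -> 'I_n) (W : 'M[R]_n) (B : pred 'I_n) i :
  is_dtmc P eta W (delta_mx 0 i) -> (forall x y, 0 <= W x y) ->
  P [set w | (hitting_time R eta B w < +oo)%E] = 1%E ->
  exists2 j, B j & connect [rel x y | 0 < W x y] i j.
Proof.
move=> [meas law_eta] W0; rewrite hitting_time_lty => hit.
apply: contrapT => noj.
have measB m : measurable [set w | B (eta m w)].
  rewrite (_ : [set w | _] = \bigcup_(j in [set j | B j]) (eta m @^-1` [set j])).
    by apply: fin_bigcup_measurable.
  by apply/seteqP; split=> w /=; [exists (eta m w)|move=> [j Bj ->]].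
have : P (\bigcup_m [set w | B (eta m w)]) = 0%E.
  apply: measure_negligible; first exact: bigcup_measurable.
  pose F (p : seq 'I_n) : set T :=
    if p is x :: q then
      if B (last x q) then
        [set w | forall m, (m <= size q)%N -> eta m w = nth i (x :: q) m]
      else set0
    else set0.
  (* Words are enumerated by [pickle]; codes that name no word ending in [B] give the empty set. *)
  pose H k : set T := if unpickle k is Some p then F p else set0.
  have : P.-negligible (\bigcup_k H k).
    apply: negligible_bigcup => k; rewrite /H.
    case: unpickle => [[|x q]|] /=; [exact: negligible_set0| |exact: negligible_set0].
    case: ifP => Bq; last exact: negligible_set0.
    exists [set w | forall m, (m <= size q)%N -> eta m w = nth i (x :: q) m]; split => //.
      rewrite (_ : [set w | _] = \bigcap_(m in [set m | (m <= size q)%N])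
                                  (eta m @^-1` [set nth i (x :: q) m])).
        by apply: bigcap_measurable => //; exists 0%N.
      by apply/seteqP; split=> w /=.
    rewrite (law_eta (size q) (nth i (x :: q))) /=; congr (_%:E).
    apply/eqP; apply: contrapT => /negP nz; apply: noj.
    move: nz; rewrite mulf_eq0 negb_or => /andP[xi].
    rewrite big_mkord => /prodf_neq0 pq.
    have xiE : x = i.
      by move: xi; rewrite mxE eqxx /=; case: (x =P i) => // _; rewrite eqxx.
    exists (last x q) => //; apply/connectP; exists q; last by rewrite -xiE.
    rewrite -xiE; apply/(pathP i) => m mq /=.
    by rewrite lt_neqAle W0 eq_sym (pq (Ordinal mq)).
  apply: negligibleS => w [m _ /= Bm].
  pose p := [seq eta k w | k <- iota 0 m.+1].
  exists (pickle p) => //; rewrite /H pickleK /F /p /=.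
  have lastE : last (eta 0%N w) [seq eta k w | k <- iota 1 m] = eta m w.
    rewrite (last_map (fun k => eta k w)).
    by case: m {Bm p} => // m; rewrite -[m.+1]addn1 iotaD last_cat /= add1n addn1.
  rewrite lastE Bm => k; rewrite size_map size_iota => km.
  rewrite -[eta 0%N w :: _]/[seq eta k w | k <- iota 0 m.+1].
  by rewrite (nth_map 0%N) ?size_iota// nth_iota.
by move=> P0; move: hit; rewrite P0 => -[] /eqP; rewrite eq_sym oner_eq0.
Qed.

(* The set where the extension of v by 0 attains a negative minimum is closed
   under the edges of the chain and disjoint from the absorbing states. *)
Lemma absorbing_min_principle (R : realType) a b (W : 'M[R]_(a + b)) (v : 'cV[R]_a) :
  (forall i : 'I_a, forall j, 0 <= W (lshift b i) j) ->
  (forall i : 'I_a, \sum_j W (lshift b i) j = 1) ->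
  (forall i : 'I_a, exists j : 'I_b,
    connect [rel x y | 0 < W x y] (lshift b i) (rshift a j)) ->
  (forall i, 0 <= ((1%:M - ulsubmx W) *m v) i 0) ->
  forall i, 0 <= v i 0.
Proof.
move=> W0 W1 Wb Uv i0; rewrite leNgt; apply/negP => vi0.
have [i1 _ min_i1] : exists2 i1, true & forall i, v i1 0 <= v i 0.
  by case: (@arg_minP _ _ _ i0 xpredT (fun i => v i 0)) => // i1 _ H; exists i1 => // i; exact: H.
have vi1 : v i1 0 < 0 by apply: le_lt_trans vi0.
pose g : 'cV_(a + b) := col_mx v 0.
have gmin x : v i1 0 <= g x 0.
  case: (split_ordP x) => k ->; rewrite ?col_mxEu ?col_mxEd ?min_i1//.
  by rewrite mxE ltW.
have step x y : g x 0 = v i1 0 -> 0 < W x y -> g y 0 = v i1 0.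
  case: (split_ordP x) => k ->; last first.
    by rewrite col_mxEd mxE => vE; move: vi1; rewrite -vE ltxx.
  rewrite col_mxEu => vk Wy.
  have := Uv k; rewrite mulmxBl mul1mx mxDE mxNE.
  have -> : (ulsubmx W *m v) k 0 = \sum_y W (lshift b k) y * g y 0.
    rewrite [RHS]big_split_ord /= [X in _ + X]big1 ?addr0; last first.
      by move=> j _; rewrite col_mxEd mxE mulr0.
    by rewrite mxE; apply: eq_bigr => j _; rewrite col_mxEu !mxE.
  (* With the row sum 1 inserted, a sum of nonpositive terms [W (min - g)] is nonnegative, so none
     of them can be negative. *)
  rewrite vk -[X in X - _]mul1r -(W1 k) mulr_suml -sumrB => sum_ge0.
  apply/eqP; rewrite eq_le gmin andbT leNgt; apply/negP => gy.
  move: sum_ge0; apply/negP; rewrite -ltNge (bigD1 y)//=.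
  rewrite ltr_wnDr//.
    by apply: sumr_le0 => z _; rewrite -mulrBr mulr_ge0_le0// subr_le0.
  by rewrite -mulrBr pmulr_rlt0// subr_lt0.
have [j /connectP[p]] := Wb i1.
have : g (lshift b i1) 0 = v i1 0 by rewrite col_mxEu.
elim: p (lshift b i1) => [|y p IHp] x gx /=.
  by move=> _ xj; move: gx vi1; rewrite -xj col_mxEd mxE => <-; rewrite ltxx.
by move=> /andP[/(step _ _ gx)/IHp]; apply.
Qed.

Lemma unitmx_mulmx_inj (F : fieldType) n (A : 'M[F]_n) :
  (forall v : 'cV_n, A *m v = 0 -> v = 0) -> A \in unitmx.
Proof.
move=> A0; rewrite -unitmx_tr -row_free_unit -kermx_eq0.
apply/eqP/row_matrixP => i; rewrite row0; apply/trmx_inj; rewrite trmx0.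
apply: A0; apply/trmx_inj; rewrite trmx_mul trmxK trmx0.
by rewrite -row_mul mulmx_ker row0.
Qed.

(** The minimum principle for [v] and for [- v] leaves only 0 in the kernel. *)
Lemma absorbing_unitmx (R : realType) a b (W : 'M[R]_(a + b)) :
  (forall i : 'I_a, forall j, 0 <= W (lshift b i) j) ->
  (forall i : 'I_a, \sum_j W (lshift b i) j = 1) ->
  (forall i : 'I_a, exists j : 'I_b,
    connect [rel x y | 0 < W x y] (lshift b i) (rshift a j)) ->
  1%:M - ulsubmx W \in unitmx.
Proof.
move=> W0 W1 Wb; apply: unitmx_mulmx_inj => v Uv.
apply/matrixP => i j; rewrite ord1 [RHS]mxE; apply/eqP; rewrite eq_le.
rewrite (absorbing_min_principle W0 W1 Wb) ?andbT; last by move=> k; rewrite Uv mxE.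
rewrite -oppr_ge0 -mxNE (absorbing_min_principle W0 W1 Wb)// => k.
by rewrite mulmxN Uv oppr0 mxE.
Qed.

(** [(I - U) K = V] is nonnegative, so the minimum principle applies to each column of [K]. Rows of
    [(U, V)] sum to 1, so [(I - U) 1 = V 1], that is [K 1 = 1]. *)
Lemma stochastic_absorption (R : realType) a b (W : 'M[R]_(a + b)) :
  (forall i : 'I_a, forall j, 0 <= W (lshift b i) j) ->
  (forall i : 'I_a, \sum_j W (lshift b i) j = 1) ->
  (forall i : 'I_a, exists j : 'I_b,
    connect [rel x y | 0 < W x y] (lshift b i) (rshift a j)) ->
  is_stochastic (invmx (1%:M - ulsubmx W) *m ursubmx W).
Proof.
move=> W0 W1 Wb; set K := _ *m _.
have unitU := absorbing_unitmx W0 W1 Wb.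
have UK : (1%:M - ulsubmx W) *m K = ursubmx W by rewrite /K mulKVmx.
split=> i.
  move=> j; have := @absorbing_min_principle _ _ _ _ (col j K) W0 W1 Wb.
  move=> /(_ _ i); rewrite [X in _ <= X]mxE; apply => k.
  by rewrite colE mulmxA UK -colE !mxE.
have : K *m const_mx 1 = const_mx 1 :> 'cV_a.
  apply: (can_inj (mulKmx unitU)).
  rewrite mulmxA UK mulmxBl mul1mx; apply/eqP; rewrite -subr_eq opprK; apply/eqP.
  apply/matrixP => k j; rewrite mxDE !mxE -[RHS](W1 k) big_split_ord /= addrC.
  by congr (_ + _); apply: eq_bigr => l _; rewrite !mxE mulr1.
move=> /matrixP/(_ i 0); rewrite [LHS]mxE [RHS]mxE => <-.
by apply: eq_bigr => k _; rewrite [const_mx _ _ _]mxE mulr1.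
Qed.

(** * Limits of the rates *)

Lemma cvg_sum_fun (R : realType) (T I : Type) (F : set_system T) (r : seq I)
    (f : I -> T -> R) (l : I -> R) :
  Filter F -> (forall i, f i x @[x --> F] --> l i) ->
  \sum_(i <- r) f i x @[x --> F] --> \sum_(i <- r) l i.
Proof.
move=> FF fl; elim: r => [|i r IHr].
  by rewrite big_nil; under eq_fun do rewrite big_nil; exact: cvg_cst.
by rewrite big_cons; under eq_fun do rewrite big_cons; exact: cvgD.
Qed.

Lemma cvg_mulmx_row (R : realType) (T : Type) (F : set_system T) m n p
    (A : T -> 'M[R]_(m, n)) (B : 'M[R]_(m, n)) (M : 'M[R]_(n, p)) i k :
  Filter F -> (forall j, A x i j @[x --> F] --> B i j) ->
  (A x *m M) i k @[x --> F] --> (B *m M) i k.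
Proof.
move=> FF AB; rewrite mxE; under eq_fun do rewrite mxE.
by apply: cvg_sum_fun => j; apply: cvgMl; exact: AB.
Qed.

Lemma exit_rateE (R : realType) n (Q : R -> 'M[R]_n) l i :
  is_rate_matrix (Q l) -> exit_rate Q l i = \sum_(j | j != i) Q l i j.
Proof.
move=> [_ /(_ i)]; rewrite (bigD1 i)//= => /eqP; rewrite addr_eq0 => /eqP Qii.
by rewrite /exit_rate Qii opprK.
Qed.

Lemma exit_rate_ge0 (R : realType) n (Q : R -> 'M[R]_n) l i :
  is_rate_matrix (Q l) -> 0 <= exit_rate Q l i.
Proof.
move=> Ql; rewrite exit_rateE//; apply: sumr_ge0 => j ji.
by rewrite Ql.1// eq_sym.
Qed.

(** As a sum of nonnegative off-diagonal rates, the exit rate converges in the extended reals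
    without any indeterminate form. *)
Lemma exit_rate_cvg (R : realType) n (Q : R -> 'M[R]_n) i :
  (forall l : R, 0 < l -> is_rate_matrix (Q l)) ->
  (forall j, i != j -> cvg ((Q l i j)%:E @[l --> +oo])) ->
  (exit_rate Q l i)%:E @[l --> +oo] --> exit_rate_lim Q i.
Proof.
move=> Qrate Qcvg.
suff : cvg ((exit_rate Q l i)%:E @[l --> +oo]) by [].
have sum_cvg : (\sum_(j | j != i) (Q l i j)%:E)%E @[l --> +oo] -->
    (\sum_(j | j != i) lim ((Q l i j)%:E @[l --> +oo%R]))%E.
  apply: cvg_nnesum => j ji; last by apply: Qcvg; rewrite eq_sym.
  near=> l; have l0 : 0 < l by near: l; exact: nbhs_pinfty_gt.
  by rewrite lee_fin (Qrate l l0).1// eq_sym.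
apply/cvgP; apply: cvg_trans sum_cvg; apply: near_eq_cvg; near=> l.
have l0 : 0 < l by near: l; exact: nbhs_pinfty_gt.
by rewrite exit_rateE ?sumEFin//; exact: Qrate.
Unshelve. all: by end_near.
Qed.

(** Off-diagonal rates lie between 0 and the exit rate, whose limit is finite; the diagonal one is
    minus the exit rate. *)
Lemma slow_rate_cvg (R : realType) n (Q : R -> 'M[R]_n) i j :
  (forall l : R, 0 < l -> is_rate_matrix (Q l)) ->
  (forall j, i != j -> cvg ((Q l i j)%:E @[l --> +oo])) ->
  (exit_rate_lim Q i < +oo)%E ->
  Q l i j @[l --> +oo] --> fine (rate_lim Q i j).
Proof.
move=> Qrate Qcvg slow_i.
have exit_cvg := exit_rate_cvg Qrate Qcvg.
have exit_ge0 : (0 <= exit_rate_lim Q i)%E.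
  apply: lime_ge; first by apply/cvgP; exact: exit_cvg.
  near=> l; rewrite lee_fin exit_rate_ge0//; apply: Qrate.
  by near: l; exact: nbhs_pinfty_gt.
have exit_fin : exit_rate_lim Q i \is a fin_num by rewrite ge0_fin_numE.
suff [Qij fin] : (Q l i j)%:E @[l --> +oo] --> rate_lim Q i j /\
    rate_lim Q i j \is a fin_num.
  by apply: (@fine_cvg _ _ _ _ (fun l => (Q l i j)%:E)); rewrite fineK.
have [<-|ij] := eqVneq i j.
  have Qii : (Q l i i)%:E @[l --> +oo] --> (- exit_rate_lim Q i)%E.
    under eq_fun do rewrite -[Q _ i i]opprK EFinN.
    exact: cvgeN.
  have -> : rate_lim Q i i = (- exit_rate_lim Q i)%E by rewrite mxE; exact/cvg_lim.
  by rewrite fin_numN.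
have limE : rate_lim Q i j = lim ((Q l i j)%:E @[l --> +oo]) by rewrite mxE.
split; first by rewrite limE; exact: Qcvg.
rewrite limE ge0_fin_numE.
  apply: le_lt_trans slow_i; apply: lee_lim; [exact: Qcvg|by apply/cvgP; exact: exit_cvg|].
  near=> l; have l0 : 0 < l by near: l; exact: nbhs_pinfty_gt.
  rewrite lee_fin exit_rateE; last exact: Qrate.
  rewrite (bigD1 j) 1?eq_sym//= lerDl; apply: sumr_ge0 => k /andP[ki _].
  by rewrite (Qrate l l0).1// eq_sym.
apply: lime_ge; first exact: Qcvg.
near=> l; have l0 : 0 < l by near: l; exact: nbhs_pinfty_gt.
by rewrite lee_fin (Qrate l l0).1.
Unshelve. all: by end_near.
Qed.

Lemma slow_rate_ge0 (R : realType) n (Q : R -> 'M[R]_n) i j :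
  (forall l : R, 0 < l -> is_rate_matrix (Q l)) ->
  (forall j, i != j -> cvg ((Q l i j)%:E @[l --> +oo])) ->
  (exit_rate_lim Q i < +oo)%E -> i != j -> 0 <= fine (rate_lim Q i j).
Proof.
move=> Qrate Qcvg slow_i ij; have Qij := slow_rate_cvg (j := j) Qrate Qcvg slow_i.
rewrite -(cvg_lim _ Qij)//; apply: limr_ge; first by apply/cvgP; exact: Qij.
near=> l; have l0 : 0 < l by near: l; exact: nbhs_pinfty_gt.
by rewrite (Qrate l l0).1.
Unshelve. all: by end_near.
Qed.

Lemma slow_rate_sum0 (R : realType) n (Q : R -> 'M[R]_n) i :
  (forall l : R, 0 < l -> is_rate_matrix (Q l)) ->
  (forall j, i != j -> cvg ((Q l i j)%:E @[l --> +oo])) ->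
  (exit_rate_lim Q i < +oo)%E -> \sum_j fine (rate_lim Q i j) = 0.
Proof.
move=> Qrate Qcvg slow_i.
have H : \sum_j Q l i j @[l --> +oo] --> \sum_j fine (rate_lim Q i j).
  by apply: cvg_sum_fun => j; exact: slow_rate_cvg.
rewrite -(cvg_lim _ H)//; apply: lim_near_cst => //.
near=> l; have l0 : 0 < l by near: l; exact: nbhs_pinfty_gt.
by rewrite (Qrate l l0).2.
Unshelve. all: by end_near.
Qed.

Lemma fast_rate_pinfty (R : realType) n (Q : R -> 'M[R]_n) i :
  (forall l : R, 0 < l -> is_rate_matrix (Q l)) ->
  (forall j, i != j -> cvg ((Q l i j)%:E @[l --> +oo])) ->
  exit_rate_lim Q i = +oo%E -> exit_rate Q l i @[l --> +oo] --> +oo.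
Proof.
move=> Qrate Qcvg fast_i; have := exit_rate_cvg Qrate Qcvg.
by rewrite fast_i => /cvgeyPge H; apply/cvgryPge => A; have := H A.
Qed.

Lemma jump_matrix_cvg (R : realType) n (Q : R -> 'M[R]_n) i j :
  (i != j -> cvg (jump_matrix Q l i j @[l --> +oo])) ->
  jump_matrix Q l i j @[l --> +oo] --> jump_lim Q i j.
Proof.
move=> Jcvg; suff : cvg (jump_matrix Q l i j @[l --> +oo]) by rewrite mxE.
have [<-|/Jcvg//] := eqVneq i j.
apply/cvgP; under eq_fun do rewrite mxE eqxx; exact: cvg_cst.
Qed.

Lemma jump_matrix_ge0 (R : realType) n (Q : R -> 'M[R]_n) l i j :
  is_rate_matrix (Q l) -> 0 <= jump_matrix Q l i j.
Proof.
move=> Ql; rewrite mxE; case: eqVneq => // ij.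
by rewrite divr_ge0 ?exit_rate_ge0 ?Ql.1.
Qed.

Lemma jump_lim_ge0 (R : realType) n (Q : R -> 'M[R]_n) i j :
  (forall l : R, 0 < l -> is_rate_matrix (Q l)) ->
  (i != j -> cvg (jump_matrix Q l i j @[l --> +oo])) -> 0 <= jump_lim Q i j.
Proof.
move=> Qrate Jcvg; have H := jump_matrix_cvg Jcvg.
rewrite mxE; apply: limr_ge; first by apply/cvgP; exact: H.
near=> l; apply/jump_matrix_ge0/Qrate; near: l; exact: nbhs_pinfty_gt.
Unshelve. all: by end_near.
Qed.

Lemma jump_matrix_sum1 (R : realType) n (Q : R -> 'M[R]_n) l i :
  is_rate_matrix (Q l) -> 0 < exit_rate Q l i -> \sum_j jump_matrix Q l i j = 1.
Proof.
move=> Ql q0; rewrite (bigD1 i)//= mxE eqxx add0r.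
rewrite -[RHS](divff (lt0r_neq0 q0)) [in X in _ = X / _]exit_rateE// mulr_suml.
by apply: eq_bigr => j ji; rewrite mxE eq_sym (negPf ji).
Qed.

Lemma jump_lim_sum1 (R : realType) n (Q : R -> 'M[R]_n) i :
  (forall l : R, 0 < l -> is_rate_matrix (Q l)) ->
  (forall j, i != j -> cvg (jump_matrix Q l i j @[l --> +oo])) ->
  exit_rate Q l i @[l --> +oo] --> +oo -> \sum_j jump_lim Q i j = 1.
Proof.
move=> Qrate Jcvg qoo.
have H : \sum_j jump_matrix Q l i j @[l --> +oo] --> \sum_j jump_lim Q i j.
  by apply: cvg_sum_fun => j; apply: jump_matrix_cvg; exact: Jcvg.
rewrite -(cvg_lim _ H)//; apply: lim_near_cst => //.
near=> l; apply: jump_matrix_sum1; first by apply: Qrate; near: l; exact: nbhs_pinfty_gt.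
by near: l; move/cvgryPgt : qoo; apply.
Unshelve. all: by end_near.
Qed.

(** Row [i] of [Q] is [q_i] times row [i] of [Omega - I]: the diverging scale is separated from a
    convergent factor. *)
Lemma mulmx_jump (R : realType) n m (Q : R -> 'M[R]_n) l (M : 'M[R]_(n, m)) i k :
  exit_rate Q l i != 0 ->
  (Q l *m M) i k = exit_rate Q l i * ((jump_matrix Q l *m M) i k - M i k).
Proof.
move=> q0; rewrite mxE (bigD1 i)//= mulrBr.
rewrite -[X in _ = _ - X]opprK -mulNr /exit_rate opprK -/(exit_rate Q l i) opprK.
rewrite addrC; congr (_ + _).
rewrite mxE [in RHS](bigD1 i)//= [X in X * M i k]mxE eqxx mul0r add0r mulr_sumr.
apply: eq_bigr => j ji; rewrite mxE eq_sym (negPf ji).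
by rewrite mulrA mulrCA mulfV// mulr1.
Qed.

Lemma mulmx_lshift (R : realType) a b m p (W : 'M[R]_(a + b, a + m)) (M : 'M[R]_(a, p))
    (N : 'M[R]_(m, p)) i k :
  (W *m col_mx M N) (lshift b i) k = (ulsubmx W *m M + ursubmx W *m N) i k.
Proof.
by rewrite -[W in LHS]submxK mul_block_col col_mxEu.
Qed.

Lemma mulmx_rshift (R : realType) a b m p (W : 'M[R]_(a + b, a + m)) (M : 'M[R]_(a, p))
    (N : 'M[R]_(m, p)) i k :
  (W *m col_mx M N) (rshift a i) k = (dlsubmx W *m M + drsubmx W *m N) i k.
Proof.
by rewrite -[W in LHS]submxK mul_block_col col_mxEd.
Qed.

Definition rate_lim_fine (R : realType) n (Q : R -> 'M[R]_n) : 'M[R]_n :=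
  map_mx fine (rate_lim Q).

Lemma rate_lim_slow_lift (R : realType) a b (Q : R -> 'M[R]_(a + b)) i k :
  (rate_lim_fine Q *m slow_lift (absorption_matrix Q)) (rshift a i) k =
  reduced_rates Q i k.
Proof.
rewrite mulmx_rshift mulmx1 addrC /reduced_rates /rate_lim_fine.
by rewrite map_dlsubmx map_drsubmx.
Qed.

(* Twice the expected number of steps that eta spends in the fast states: the
   factor 2 leaves room for q_i(l) <= - (Q(l) z)_i at finite l. *)
Definition fast_visits (R : realType) a b (Q : R -> 'M[R]_(a + b)) : 'cV[R]_(a + b) :=
  col_mx (invmx (1%:M - ulsubmx (jump_lim Q)) *m const_mx 2) 0.

Lemma fast_jump_bound (R : realType) a b (Q : R -> 'M[R]_(a + b)) (i : 'I_a) :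
  exit_rate Q l (lshift b i) @[l --> +oo] --> +oo ->
  (forall j, lshift b i != j -> cvg (jump_matrix Q l (lshift b i) j @[l --> +oo])) ->
  1%:M - ulsubmx (jump_lim Q) \in unitmx ->
  \forall l \near +oo,
    exit_rate Q l (lshift b i) <= - (Q l *m fast_visits Q) (lshift b i) 0.
Proof.
move=> qoo Jcvg unitU; set x := lshift b i in qoo Jcvg *.
have zE : (jump_lim Q *m fast_visits Q) x 0 = fast_visits Q x 0 - 2.
  rewrite /fast_visits mulmx_lshift mulmx0 addr0 col_mxEu.
  set z := invmx _ *m _.
  have : (1%:M - ulsubmx (jump_lim Q)) *m z = const_mx 2 by rewrite mulKVmx.
  move=> /matrixP/(_ i 0); rewrite mulmxBl mul1mx mxDE mxNE const_mxE; lra.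
have Jz : (jump_matrix Q l *m fast_visits Q) x 0 @[l --> +oo] --> fast_visits Q x 0 - 2.
  rewrite -zE; apply: cvg_mulmx_row => j.
  by apply: jump_matrix_cvg; exact: Jcvg.
near=> l.
have q0 : 0 < exit_rate Q l x by near: l; move/cvgryPgt : qoo; apply.
rewrite mulmx_jump ?gt_eqF// -mulrN ler_peMr ?(ltW q0)//.
(* The limit of [(Omega z - z) x] is -2, so it is eventually at most -1. *)
have : (jump_matrix Q l *m fast_visits Q) x 0 <= fast_visits Q x 0 - 1.
  by near: l; apply: (cvgr_le _ Jz); lra.
lra.
Unshelve. all: by end_near.
Qed.

(** After division by [q_i], the term [Q J] becomes [Omega J - J], which vanishes in the limit by
    harmonicity, and the fixed [J G] is killed by the diverging [q_i]. *)
Lemma fast_intertwine (R : realType) a b (Q : R -> 'M[R]_(a + b)) (i : 'I_a) eps :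
  exit_rate Q l (lshift b i) @[l --> +oo] --> +oo ->
  (forall j, lshift b i != j -> cvg (jump_matrix Q l (lshift b i) j @[l --> +oo])) ->
  1%:M - ulsubmx (jump_lim Q) \in unitmx -> 0 < eps ->
  let J := slow_lift (absorption_matrix Q) in
  \forall l \near +oo,
    \sum_k `|(Q l *m J - J *m reduced_rates Q) (lshift b i) k| <=
      eps * exit_rate Q l (lshift b i).
Proof.
move=> qoo Jcvg unitU eps0 J; set x := lshift b i in qoo Jcvg *.
have JE k : (jump_lim Q *m J) x k = J x k.
  rewrite /J /slow_lift mulmx_lshift mulmx1 col_mxEu.
  have /matrixP/(_ i k) : (1%:M - ulsubmx (jump_lim Q)) *m absorption_matrix Q =
      ursubmx (jump_lim Q) by rewrite mulKVmx.
  by rewrite mulmxBl mul1mx !mxDE mxNE => <-; ring.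
have qV : (exit_rate Q l x)^-1 @[l --> +oo] --> (0 : R).
  by apply/gtr0_cvgV0 => //; move/cvgryPgt : qoo; apply.
pose r l := \sum_k (`|(jump_matrix Q l *m J) x k - J x k| +
  `|(J *m reduced_rates Q) x k| * (exit_rate Q l x)^-1).
have r0 : r l @[l --> +oo] --> (0 : R).
  rewrite [X in _ --> X](_ : _ = \sum_(k < b) (0 : R)); last by rewrite big1.
  apply: cvg_sum_fun => k; rewrite -[X in _ --> X]addr0; apply: cvgD.
    rewrite -[X in _ --> X](normr0 R); apply: cvg_norm.
    rewrite -[X in _ --> X](subrr (J x k)); apply: cvgB; last exact: cvg_cst.
    rewrite -JE; apply: cvg_mulmx_row => j.
    by apply: jump_matrix_cvg; exact: Jcvg.
  by rewrite -[X in _ --> X](mulr0 `|(J *m reduced_rates Q) x k|); apply: cvgMr.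
near=> l.
have q0 : 0 < exit_rate Q l x by near: l; move/cvgryPgt : qoo; apply.
have rl : r l <= eps by near: l; apply: (cvgr_le _ r0).
apply: (@le_trans _ _ (r l * exit_rate Q l x)); last by rewrite ler_pM2r.
rewrite /r mulr_suml; apply: ler_sum => k _.
rewrite /= mxDE mxNE mulmx_jump ?gt_eqF// mulrDl mulfVK ?gt_eqF//.
apply: le_trans (ler_normB _ _) _.
by rewrite lerD2r normrM mulrC (gtr0_norm q0).
Unshelve. all: by end_near.
Qed.

Lemma slow_mulmx_cvg (R : realType) a b p (Q : R -> 'M[R]_(a + b)) (M : 'M[R]_(a + b, p)) i k :
  (forall l : R, 0 < l -> is_rate_matrix (Q l)) ->
  (forall j, i != j -> cvg ((Q l i j)%:E @[l --> +oo])) ->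
  (exit_rate_lim Q i < +oo)%E ->
  (Q l *m M) i k @[l --> +oo] --> (rate_lim_fine Q *m M) i k.
Proof.
move=> Qrate Qcvg slow_i; apply: cvg_mulmx_row => j; rewrite [X in _ --> X]mxE.
exact: slow_rate_cvg.
Qed.

(** On slow rows [J G] is [G] itself, and [Q J] converges to it by the definition of the reduced
    rates. *)
Lemma slow_intertwine (R : realType) a b (Q : R -> 'M[R]_(a + b)) (i : 'I_b) eps :
  (forall l : R, 0 < l -> is_rate_matrix (Q l)) ->
  (forall j, rshift a i != j -> cvg ((Q l (rshift a i) j)%:E @[l --> +oo])) ->
  (exit_rate_lim Q (rshift a i) < +oo)%E -> 0 < eps ->
  let J := slow_lift (absorption_matrix Q) in
  \forall l \near +oo,
    \sum_k `|(Q l *m J - J *m reduced_rates Q) (rshift a i) k| <= eps.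
Proof.
move=> Qrate Qcvg slow_i eps0 J.
have r0 : \sum_k `|(Q l *m J) (rshift a i) k - (J *m reduced_rates Q) (rshift a i) k|
    @[l --> +oo] --> (0 : R).
  rewrite [X in _ --> X](_ : _ = \sum_(k < b) (0 : R)); last by rewrite big1.
  apply: cvg_sum_fun => k; rewrite -[X in _ --> X](normr0 R); apply: cvg_norm.
  rewrite -[X in _ --> X](subrr (reduced_rates Q i k)); apply: cvgB.
    by rewrite -rate_lim_slow_lift; exact: slow_mulmx_cvg.
  rewrite /J /slow_lift mul_col_mx col_mxEd mul1mx; exact: cvg_cst.
near=> l; under eq_bigr do rewrite mxDE mxNE.
by near: l; apply: (cvgr_le _ r0).
Unshelve. all: by end_near.
Qed.

(** * Laws of the two chains and conclusion *)

Lemma law_ctmc d (T : measurableType d) (R : realType) n (P : probability T R)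
    (X : R -> T -> 'I_n) (Q : 'M[R]_n) mu t :
  is_ctmc P X Q mu -> 0 <= t -> law P (X t) = mu *m expmx (t *: Q).
Proof.
move=> [meas fdd] t0; apply/rowP => j; rewrite mxE mxE.
pose D i := X 0 @^-1` [set i] `&` X t @^-1` [set j].
have PD i : P (D i) = (mu 0 i * expmx (t *: Q) i j)%:E.
  (* The joint law at times 0 and [t]; the state at time 0 is summed out below. *)
  have := fdd 1%N (fun m => if m is 0%N then 0 else t) (fun m => if m is 0%N then i else j).
  rewrite big_nat1 subr0 => <- //; last by case.
  congr (P _); apply/seteqP; split=> w /=.
    by move=> [X0 Xt] [|[|m]].
  by move=> Xw; split; [exact: (Xw 0%N)|exact: (Xw 1%N)].
have -> : X t @^-1` [set j] = \big[setU/set0]_(i < n) D i.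
  rewrite -bigcup_seq; apply/seteqP; split=> w /=; last by move=> [i _ []].
  by move=> Xw; exists (X 0 w) => //=; rewrite mem_index_enum.
rewrite measure_bigsetU_ord//.
- by rewrite (eq_bigr _ (fun i _ => PD i)) sumEFin.
- by move=> i; apply: measurableI; exact: meas.
- by move=> i k _ _ [w [[/= <- _] [/= <- _]]].
Qed.

(** The reduced rates are the slow rows of [Q J]. Off the diagonal, the negative entry of [Q] meets
    a zero of [J]; row sums vanish because [J 1 = 1]. *)
Lemma reduced_rates_is_rate (R : realType) a b (Q : R -> 'M[R]_(a + b)) :
  (forall l : R, 0 < l -> is_rate_matrix (Q l)) ->
  (forall i j, i != j -> cvg ((Q l i j)%:E @[l --> +oo])) ->
  (forall i : 'I_b, (exit_rate_lim Q (rshift a i) < +oo)%E) ->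
  is_stochastic (absorption_matrix Q) -> is_rate_matrix (reduced_rates Q).
Proof.
move=> Qrate Qcvg slow_b Kst; split=> i.
  move=> j ij; rewrite -rate_lim_slow_lift mxE big_split_ord /=.
  have [J0 _] := stochastic_slow_lift Kst.
  apply: addr_ge0; apply: sumr_ge0 => k _.
    rewrite mulr_ge0// [X in 0 <= X]mxE slow_rate_ge0//; first by move=> ?; exact: Qcvg.
    by rewrite eq_sym eq_lrshift.
  have [->|ik] := eqVneq k i; first by rewrite col_mxEd [X in _ * X]mxE (negPf ij) mulr0.
  rewrite mulr_ge0// [X in 0 <= X]mxE slow_rate_ge0//; first by move=> ?; exact: Qcvg.
  by rewrite eq_sym (inj_eq (@rshift_inj _ _)).
under eq_bigr do rewrite -rate_lim_slow_lift mxE.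
rewrite exchange_big /=.
have [_ J1] := stochastic_slow_lift Kst.
under eq_bigr do rewrite -mulr_sumr J1 mulr1 mxE.
by apply: slow_rate_sum0 => // j; exact: Qcvg.
Qed.

Lemma reduced_kernel_uniform_cvg (R : realType) a b (Q : R -> 'M[R]_(a + b)) h :
  (forall l : R, 0 < l -> is_rate_matrix (Q l)) ->
  (forall i j, i != j -> cvg ((Q l i j)%:E @[l --> +oo])) ->
  (forall i j, i != j -> cvg (jump_matrix Q l i j @[l --> +oo])) ->
  (forall i : 'I_a, exit_rate_lim Q (lshift b i) = +oo%E) ->
  (forall i : 'I_b, (exit_rate_lim Q (rshift a i) < +oo)%E) ->
  (forall i : 'I_a, exists j : 'I_b,
    connect [rel x y | 0 < jump_lim Q x y] (lshift b i) (rshift a j)) ->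
  irreducible_rates (reduced_rates Q) -> (0 < b)%N -> 0 < h ->
  forall err, 0 < err -> \forall l \near +oo, forall t i, h <= t ->
    \sum_j `|expmx (t *: Q l) i j -
             reduced_kernel (absorption_matrix Q) (reduced_rates Q) t i j| <= err.
Proof.
move=> Qrate Qcvg Jcvg fast_a slow_b hit Girr b0 h0.
have qoo (i : 'I_a) : exit_rate Q l (lshift b i) @[l --> +oo] --> +oo.
  by apply: fast_rate_pinfty => // j; exact: Qcvg.
have W0 (i : 'I_a) j : 0 <= jump_lim Q (lshift b i) j.
  by apply: jump_lim_ge0 => //; exact: Jcvg.
have W1 (i : 'I_a) : \sum_j jump_lim Q (lshift b i) j = 1.
  by apply: jump_lim_sum1 => // j; exact: Jcvg.
have unitU := absorbing_unitmx W0 W1 hit.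
have Kst := stochastic_absorption W0 W1 hit.
have Grate := reduced_rates_is_rate Qrate Qcvg slow_b Kst.
have z0 i : 0 <= fast_visits Q i 0.
  case: (split_ordP i) => k ->; last by rewrite col_mxEd mxE.
  rewrite col_mxEu; apply: (absorbing_min_principle W0 W1 hit) => {}k.
  by rewrite mulKVmx// mxE.
pose c (i : 'I_b) := `|(rate_lim_fine Q *m fast_visits Q) (rshift a i) 0| +
  `|(rate_lim_fine Q *m fast_indicator R a b) (rshift a i) 0|.
(* On slow rows [d = 1] uses one unit of the 2; the other is the slack that turns an inequality
   between limits into an eventual one. *)
pose C := 2 + \sum_i c i.
have c0 i : 0 <= c i by rewrite addr_ge0.
have cC i : c i <= C - 2.
  by rewrite /C addrC addKr (bigD1 i)//= lerDl sumr_ge0.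
have C0 : 0 <= C by rewrite addr_ge0// sumr_ge0.
apply: (@reduced_kernel_cvg _ _ _ _ _ _ (fast_visits Q) C (\sum_i fast_visits Q i 0)) => //.
- by move=> i; rewrite z0 (bigD1 i)//= lerDl sumr_ge0.
- apply: filter_forall => i; case: (split_ordP i) => k ->.
    near=> l; have l0 : 0 < l by near: l; exact: nbhs_pinfty_gt.
    (* On a fast row, [Q] applied to the indicator is minus the total rate to the slow states. *)
    apply: le_trans C0; have [Q0 Q1] := Qrate l l0.
    rewrite mxE big_split_ord /= [X in _ + X]big1 ?addr0; last first.
      by move=> j _; rewrite col_mxEd mxE mulr0.
    under eq_bigr do rewrite col_mxEu const_mxE mulr1.
    have := Q1 (lshift b k); rewrite big_split_ord /= => /eqP.
    rewrite addr_eq0 => /eqP ->; rewrite oppr_le0 sumr_ge0// => j _.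
    by rewrite Q0// eq_lrshift.
  have H := slow_mulmx_cvg (M := fast_indicator R a b) (k := 0) Qrate
    (Qcvg (rshift a k)) (slow_b k).
  apply: (cvgr_le _ H); have := cC k; rewrite /c.
  have := ler_norm ((rate_lim_fine Q *m fast_indicator R a b) (rshift a k) 0).
  by have := normr_ge0 ((rate_lim_fine Q *m fast_visits Q) (rshift a k) 0); lra.
move=> eps eps0; apply: filter_forall => i; case: (split_ordP i) => k ->.
  near=> l; exists (exit_rate Q l (lshift b k)).
    split.
      rewrite ler_wpDl//; near: l; apply: fast_jump_bound => // j; exact: Jcvg.
    rewrite col_mxEu mxE mulrC -ler_pdivrMr//.
    by near: l; move/cvgryPge : (qoo k); apply.
  near: l; apply: fast_intertwine => // j; exact: Jcvg.
have H := slow_mulmx_cvg (M := fast_visits Q) (k := 0) Qrate (Qcvg (rshift a k)) (slow_b k).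
near=> l; exists 1; rewrite mulr1.
  split; last by rewrite col_mxEd mxE ltW.
  rewrite lerBrDr addrC -lerBrDr; near: l; apply: (cvgr_le _ H); have := cC k; rewrite /c.
  have := ler_norm ((rate_lim_fine Q *m fast_visits Q) (rshift a k) 0).
  by have := normr_ge0 ((rate_lim_fine Q *m fast_indicator R a b) (rshift a k) 0); lra.
by near: l; apply: slow_intertwine => // j; exact: Qcvg.
Unshelve. all: by end_near.
Qed.

(** [mu J] is the reduced distribution. *)
Lemma extend_reduced_law (R : realType) a b (Q : R -> 'M[R]_(a + b)) mu t :
  extend_by_zero a (reduced_distribution Q mu *m expmx (t *: reduced_rates Q)) =
  mu *m reduced_kernel (absorption_matrix Q) (reduced_rates Q) t.
Proof.
rewrite /reduced_kernel mul_mx_row mulmx0 mulmxA; congr (row_mx _ (_ *m _)).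
by rewrite -[mu in RHS]hsubmxK mul_row_col mulmx1 addrC.
Qed.

Lemma dTV_mulmx_le (R : realType) n (mu : 'rV[R]_n) (P S : 'M[R]_n) err :
  is_distribution mu -> 0 <= err -> (forall i, \sum_j `|P i j - S i j| <= err) ->
  dTV (mu *m P) (mu *m S) <= err.
Proof.
move=> [mu0 mu1] err0 PS; rewrite /dTV.
suff : \sum_j `|(mu *m P) 0 j - (mu *m S) 0 j| <= err by lra.
apply: (@le_trans _ _ (\sum_j \sum_i mu 0 i * `|P i j - S i j|)).
  apply: ler_sum => j _; rewrite -mxNE -mxDE -mulmxBr mxE.
  apply: le_trans (ler_norm_sum _ _ _) _; apply: ler_sum => i _.
  by rewrite normrM ger0_norm// mxDE mxNE.
rewrite exchange_big /= -[leRHS]mul1r -mu1 mulr_suml.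
by apply: ler_sum => i _; rewrite -mulr_sumr ler_wpM2l.
Qed.

Lemma dTV_ge0 (R : realType) n (mu nu : 'rV[R]_n) : 0 <= dTV mu nu.
Proof. by rewrite mulr_ge0 ?invr_ge0// sumr_ge0. Qed.

Theorem theorem6 (R : realType) (a b : nat) (Q : R -> 'M[R]_(a + b))
  (* the rate matrices Q(l) and their limits *)
  (Q_rate : forall l : R, 0 < l -> is_rate_matrix (Q l))
  (Q_irr : forall l : R, 0 < l -> irreducible_rates (Q l))
  (Q_cvg : forall i j : 'I_(a + b), i != j -> cvg ((Q l i j)%:E @[l --> +oo]))
  (* the first a states are the fast ones; slow states exist, with q_i > 0 *)
  (fastE : forall i : 'I_(a + b), fast Q i = (i < a)%N)
  (slow_ex : exists i : 'I_(a + b), slow Q i)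
  (slow_gt0 : forall i : 'I_(a + b), slow Q i -> (0 < exit_rate_lim Q i)%E)
  (* the jump chain eta, under its laws P_i, i in S *)
  (jump_cvg : forall i j : 'I_(a + b), i != j ->
    cvg (jump_matrix Q l i j @[l --> +oo]))
  (d0 : measure_display) (T0 : measurableType d0)
  (P0 : 'I_(a + b) -> probability T0 R) (eta : nat -> T0 -> 'I_(a + b))
  (eta_chain : forall i : 'I_(a + b),
    is_dtmc (P0 i) eta (jump_lim Q) (delta_mx 0 i))
  (eta_hit : forall i : 'I_(a + b), fast Q i ->
    P0 i [set w | (hitting_time R eta (slow Q) w < +oo)%E] = 1%E)
  (* the reduced chain is irreducible *)
  (Y_irr : irreducible_rates (reduced_rates Q))
  (mu : 'rV[R]_(a + b)) (mu_distr : is_distribution mu)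
  (* the chain X, under its laws P^l_mu, l > 0 *)
  (d1 : measure_display) (T1 : measurableType d1)
  (P1 : R -> probability T1 R) (X : R -> T1 -> 'I_(a + b))
  (X_chain : forall l : R, 0 < l -> is_ctmc (P1 l) X (Q l) mu)
  (* the chain Y, under its law P_(gamma(mu)) *)
  (d2 : measure_display) (T2 : measurableType d2)
  (P2 : probability T2 R) (Y : R -> T2 -> 'I_b)
  (Y_chain : is_ctmc P2 Y (reduced_rates Q) (reduced_distribution Q mu))
  (h : R) (h_gt0 : 0 < h) :
  ereal_sup [set (dTV (law (P1 l) (X t)) (extend_by_zero a (law P2 (Y t))))%:E
            | t in [set t : R | h <= t]] @[l --> +oo] --> 0%E.
Proof.
have Qcvg i j : i != j -> cvg ((Q l i j)%:E @[l --> +oo]) by exact: Q_cvg.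
have fast_a (i : 'I_a) : exit_rate_lim Q (lshift b i) = +oo%E.
  by apply/eqP; have := fastE (lshift b i); rewrite /fast /= ltn_ord.
have slow_b (i : 'I_b) : (exit_rate_lim Q (rshift a i) < +oo)%E.
  rewrite ltey; have := fastE (rshift a i); rewrite /fast /= ltnNge leq_addr /=.
  by move=> ->.
have b0 : (0 < b)%N.
  case: slow_ex => i; rewrite /slow; case: (split_ordP i) => k ->.
    by rewrite fast_a.
  by move=> _; exact: leq_ltn_trans (ltn_ord k).
have hit (i : 'I_a) : exists j : 'I_b,
    connect [rel x y | 0 < jump_lim Q x y] (lshift b i) (rshift a j).
  have W0 x y : 0 <= jump_lim Q x y by apply: jump_lim_ge0 => //; exact: jump_cvg.
  have fast_i : fast Q (lshift b i) by rewrite fastE /= ltn_ord.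
  have [j slow_j ij] := dtmc_hit_connect (eta_chain _) W0 (eta_hit _ fast_i).
  case: (split_ordP j) slow_j ij => k -> slow_k ij; last by exists k.
  by move: slow_k; rewrite /slow fast_a.
have close := reduced_kernel_uniform_cvg Q_rate Qcvg jump_cvg fast_a slow_b hit Y_irr b0 h_gt0.
pose D l t := dTV (law (P1 l) (X t)) (extend_by_zero a (law P2 (Y t))).
pose sup l := ereal_sup [set (D l t)%:E | t in [set t : R | h <= t]].
have sup_ge0 l : (0 <= sup l)%E.
  apply: (@le_trans _ _ (D l h)%:E); first by rewrite lee_fin dTV_ge0.
  by apply: ereal_sup_ubound; exists h => //=.
have sup_le err : 0 < err -> \forall l \near +oo, (sup l <= err%:E)%E.
  move=> err0; near=> l; have l0 : 0 < l by near: l; exact: nbhs_pinfty_gt.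
  apply: ge_ereal_sup => _ [t /= ht <-]; rewrite lee_fin.
  have t0 : 0 <= t by apply: le_trans ht; exact: ltW.
  rewrite /D (law_ctmc (X_chain _ l0) t0) (law_ctmc Y_chain t0) extend_reduced_law.
  apply: dTV_mulmx_le => //; first exact: ltW.
  move=> i; move: t i ht {t0}; near: l; exact: close.
(* The supremum is an extended real: it is eventually finite, by the bound with [err = 1], and its
   real values then tend to 0. *)
apply/fine_cvgP; split.
  near=> l; rewrite ge0_fin_numE ?sup_ge0//.
  by apply: (@le_lt_trans _ _ 1%:E); [near: l; exact: sup_le|exact: ltry].
apply/cvgrPdist_le => err err0; near=> l.
have : (sup l <= err%:E)%E by near: l; exact: sup_le.
rewrite /= sub0r normrN -/(sup l); move: (sup_ge0 l).
case: (sup l) => [r| |] //=; rewrite ?lee_fin => r0 re.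
by rewrite ger0_norm.
Unshelve. all: by end_near.
Qed.
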